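(* Let $\mathcal G$ be a random graph on the vertex set $V$ which satisfies the BK inequality, and suppose that for some $\alpha\in(\tfrac{3d}{4},d)$ there exists $C>0$ such that $\tau(x,y)\le C\, g_\alpha(x,y)$ for all $x,y\in V$. Let $\mathcal C_0$ and $\widetilde{\mathcal C}_0$ be two independent copies of the connected component of $0$ in $\mathcal G$. Then there exists $\kappa>0$ such that $$\mathbb E\Big[\exp\big(\kappa\cdot|\mathcal C_0 \cap \widetilde{\mathcal C}_0|^{\frac{2\alpha}{d}-1}\big)\Big]<\infty.$$
   Context: $(V,d_V)$ is a countable metric space, with balls $B(x,r)=\{y\in V: d_V(x,y)\le r\}$, of polynomial volume growth: there are a real $d\ge 1$ and constants $c_1,c_2>0$ with $c_1 r^d\le |B(x,r)|\le c_2 r^d$ for all $x\in V$, $r\ge 1$. A vertex $0\in V$ is fixed arbitrarily. $\mathcal G$ is a random graph with deterministic vertex set $V$ and possibly random edge set; $\{x\longleftrightarrow y\}$ is the event that $x$ and $y$ are connected in $\mathcal G$, and $\tau(x,y)=\mathbb P(x\longleftrightarrow y)$. For $\alpha>0$, $g_\alpha(x,y)=\frac{1}{1+d_V(x,y)^\alpha}$. BK inequality: an event $E$ is increasing if whenever $\{\mathcal G=A\}\subseteq E$ for a fixed graph $A$ with vertex set $V$, then $\{\mathcal G=B\}\subseteq E$ for every graph $B$ on $V$ containing $A$ as a subgraph. A finite graph $A$ witnesses $E$ if $\{A\subseteq\mathcal G\}\subseteq E$. For increasing events $E,F$, $E\circ F$ is the event that there exist two finite subgraphs of $\mathcal G$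 with disjoint edge sets, one witnessing $E$ and the other witnessing $F$. $\mathcal G$ satisfies the BK inequality if $\mathbb P(E\circ F)\le \mathbb P(E)\,\mathbb P(F)$ for all increasing events $E,F$. *)

(* Defs.v *)
From HB Require Import structures.
From mathcomp Require Import all_boot all_order all_algebra.
From mathcomp Require Import all_classical all_reals all_analysis.

Set Implicit Arguments.
Unset Strict Implicit.
Unset Printing Implicit Defensive.

Import Order.TTheory GRing.Theory Num.Theory.

Local Open Scope classical_set_scope.
Local Open Scope ring_scope.

Definition closed_ball_mdist (R : realType) (V : metricType R) (x : V) (r : R)
  : set V := [set y | mdist x y <= r].

(* [counting] is +oo on infinite sets, so the upper bound forces balls to be
   finite. *)
Definition polynomial_growth (R : realType) (V : metricType R) (d : R) : Prop :=
  exists c1 c2 : R, [/\ 0 < c1, 0 < c2 &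
    forall (x : V) (r : R), 1 <= r ->
      ((c1 * r `^ d)%:E <= counting (closed_ball_mdist x r)
         <= (c2 * r `^ d)%:E)%E].

Definition green (R : realType) (V : metricType R) (alpha : R) (x y : V) : R :=
  (1 + mdist x y `^ alpha)^-1.

Record graph (V : Type) := Graph {
  adj :> rel V;
  adj_sym : symmetric adj;
  adj_irr : irreflexive adj }.

Definition empty_graph (V : Type) : graph V :=
  @Graph V (fun _ _ => false) (fun _ _ => erefl) (fun _ => erefl).

HB.instance Definition _ (V : Type) := gen_eqMixin (graph V).
HB.instance Definition _ (V : Type) := gen_choiceMixin (graph V).
HB.instance Definition _ (V : Type) := isPointed.Build (graph V) (empty_graph V).

Definition edge_cylinders (V : Type) : set (set (graph V)) :=
  range (fun e : V * V => [set A : graph V | A e.1 e.2]).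

(* graphs on V, with the product sigma-algebra *)
Definition graph_space (V : Type) := g_sigma_algebraType (@edge_cylinders V).

Definition point_cylinders (V : Type) : set (set (set V)) :=
  range (fun x : V => [set S : set V | S x]).

(* subsets of V, with the product sigma-algebra *)
Definition subset_space (V : Type) := g_sigma_algebraType (@point_cylinders V).

Section graphs.
Variable V : choiceType.
Implicit Types A B H : graph V.

Definition connected A (x y : V) : Prop :=
  exists p : seq V, path A x p /\ last x p = y.

Definition component A (x : V) : set V := [set y | connected A x y].

Definition subgraph A B : Prop := forall x y, A x y -> B x y.

(* A finite subgraph is encoded by its edges only: since the vertex set of the
   random graph is all of V, its (finite) vertex set plays no role. *)
Definition finite_graph A : Prop := finite_set [set e : V * V | A e.1 e.2].

Definition edge_disjoint A B : Prop := forall x y, ~ (A x y /\ B x y).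

(* Events concerning the random graph are sets of graphs E, standing for
   {G \in E}. *)
Definition increasing (E : set (graph V)) : Prop :=
  forall A B, subgraph A B -> E A -> E B.

Definition witnesses A (E : set (graph V)) : Prop :=
  finite_graph A /\ [set H | subgraph A H] `<=` E.

Definition disjoint_occurrence (E F : set (graph V)) : set (graph V) :=
  [set H | exists A B, [/\ subgraph A H, subgraph B H, edge_disjoint A B,
                           witnesses A E & witnesses B F]].

End graphs.

Section random_graphs.
Context (R : realType) (V : choiceType) (dT : measure_display)
  (T : measurableType dT) (P : probability T R).
Local Open Scope ereal_scope.

Definition BK_inequality (G : {mfun T >-> graph_space V}) : Prop :=
  forall E F : set (graph_space V), measurable E -> measurable F ->
    increasing E -> increasing F ->
    P (G @^-1` disjoint_occurrence E F) <= P (G @^-1` E) * P (G @^-1` F).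

Definition tau (G : {mfun T >-> graph_space V}) (x y : V) : \bar R :=
  P [set w | connected (G w) x y].

(* C1 and C2, defined on some other probability space, are independent and each
   has the law of the connected component of o in G. *)
Definition independent_copies_of_component
    (G : {mfun T >-> graph_space V}) (o : V)
    (dT' : measure_display) (T' : measurableType dT') (P' : probability T' R)
    (C1 C2 : {mfun T' >-> subset_space V}) : Prop :=
  [/\ forall S : set (subset_space V), measurable S ->
        P' (C1 @^-1` S) = P [set w | S (component (G w) o)],
      forall S : set (subset_space V), measurable S ->
        P' (C2 @^-1` S) = P [set w | S (component (G w) o)] &
      forall S1 S2 : set (subset_space V), measurable S1 -> measurable S2 ->
        P' (C1 @^-1` S1 `&` C2 @^-1` S2) = P' (C1 @^-1` S1) * P' (C2 @^-1` S2)].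

End random_graphs.

(* Main.v *)
Require Import Defs.
From mathcomp Require Import all_boot all_order all_algebra.
From mathcomp Require Import all_classical all_reals all_analysis.
From mathcomp Require Import measurable_realfun lra zify.

(** Write [N] for the number of common points of the two clusters and [s] for
    [2 alpha / d - 1].  The moment is finite because [N >= n] has probability
    at most [B exp (- k n^s)].

    Scales are dyadic.  With [l x y] the least [j] such that [x] and [y] are at
    distance at most [2^j], [a = 2^(- alpha)] and [D = 2^d], the two-point
    function is at most [C a^(l x y)] and balls of level [j] have at most
    [c D^j] points.  The convolution of [a^l] with itself is of order [beta^l],
    where [beta = a^2 D], and [1 / beta = D^s].  The assumptions on [alpha] read
    [a D > 1] and [a^4 D^3 = D beta^2 < 1].

    One cluster against a fixed finite set.  Suppose that the potential
    [sum_z beta^(l v z)], [z] ranging over the set, is at most [S] for every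
    [v].  If [x] is connected to at least two targets, a path from [x] leads to
    a point [y] from which two disjoint parts of the graph reach two
    complementary families of targets ([connects_branch]).  By the BK inequality
    the generating function [u x = sum_A theta^|A| P (x connected to all of A)],
    over nonempty sets [A] of targets, satisfies
    [u <= theta h + sum_y tau(., y) u(y)^2], where [h] bounds the expected
    number of targets reached ([subset_gf_step]).  The inequality
    [sum_y a^(l x y) h(y)^2 <= Q S h(x)] ([green_square_le]) propagates the
    bound [u <= 2 theta h] as soon as [theta] is a small multiple of [1 / S].
    Since [1 + u] is the expectation of [(1 + theta)^count], the number of
    targets reached has an exponential tail at scale [S]
    ([cluster_count_tail]).

    Two clusters at [n = D^m].  Common points beyond level [M ~ beta^(- m)] are
    excluded by a first moment ([common_far_le]).  Within level [M] the first
    cluster is tested against the trace of the second one.  For a ball of level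
    [j] the potential is of order [(D beta)^j], so outside an event of
    probability [B exp (- beta^(- m))] the second cluster has at most
    [K beta^(- m) (D beta)^j] points in every relevant ball of level [j > m].
    These counts, weighted by [beta^j], sum to order [(D beta)^m] because
    [D beta^2 < 1]: this is where [alpha > 3 d / 4] enters
    ([clustered_potential_le]).  Independence and the tail for one cluster then
    give [exp (- k D^m / (D beta)^m) = exp (- k beta^(- m))]
    ([common_near_le]).

    Summing [exp (kappa beta^(- m - 1))] against these tails over [m] bounds the
    exponential moment ([stretched_exponential_moment]). *)

Set Implicit Arguments.
Unset Strict Implicit.
Unset Printing Implicit Defensive.

Import Order.TTheory GRing.Theory Num.Theory.
Local Open Scope classical_set_scope.
Local Open Scope ring_scope.

(* Topological connectedness bears the same name. *)
Local Notation connected := Defs.connected.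

(** * Sums over dyadic shells *)

Section geometric.
Context (R : realFieldType).
Implicit Types q : R.

Lemma geometric_tail_le q m n : 0 <= q -> q < 1 ->
  \sum_(m <= k < n) q ^+ k <= q ^+ m / (1 - q).
Proof.
move=> q0 q1; have d0 : 0 < 1 - q by rewrite subr_gt0.
have [nm|/ltnW mn] := leqP n m.
  by rewrite big_geq// divr_ge0 ?exprn_ge0// ltW.
rewrite ler_pdivlMr// mulr_suml.
rewrite (@telescope_sumr_eq _ _ _ (fun k => - q ^+ k))//.
  by rewrite opprK addrC gerBl exprn_ge0.
by move=> k _; rewrite exprS; lra.
Qed.

Lemma geometric_growing_le q n : 1 < q ->
  \sum_(k < n) q ^+ k <= q ^+ n / (q - 1).
Proof.
move=> q1; have d0 : 0 < q - 1 by rewrite subr_gt0.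
rewrite ler_pdivlMr// mulrC -subrX1 gerBl//.
Qed.

End geometric.

Section level_sums.
Context (R : realFieldType) (V : eqType).

(** Group the terms by the value of [f]: level [k] carries weight [phi k] and
    at most [F k] terms. *)
Lemma sum_by_level_le (phi F : nat -> R) (f : V -> nat) (s : seq V) n :
  (forall k, 0 <= phi k) ->
  (forall y, y \in s -> f y < n)%N ->
  (forall k, (k < n)%N -> (count (fun y => f y == k) s)%:R <= F k) ->
  \sum_(y <- s) phi (f y) <= \sum_(k < n) phi k * F k.
Proof.
move=> phi0 fn cF.
have -> : \sum_(y <- s) phi (f y) =
    \sum_(y <- s) \sum_(k < n) (f y == k)%:R * phi k.
  rewrite [LHS]big_seq [RHS]big_seq; apply: eq_bigr => y ys.
  rewrite (bigD1 (Ordinal (fn _ ys)))//= eqxx mul1r big1 ?addr0// => k kf.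
  by rewrite eq_sym -val_eqE/= in kf; rewrite (negPf kf) mul0r.
rewrite exchange_big/=; apply: ler_sum => k _.
rewrite -mulr_suml mulrC ler_wpM2l// -natr_sum.
apply: le_trans (cF k (ltn_ord k)).
by rewrite ler_nat -sum1_count [leqRHS]big_mkcond/=.
Qed.

(** What remains of the triangle inequality on dyadic levels: the constant two
    of the doubled distance becomes one extra level. *)
Definition quasi_ultrametric (l : V -> V -> nat) :=
  (forall x y, l x y = l y x) /\
  (forall y x z, l x z <= (maxn (l x y) (l y z)).+1)%N.

(** The volume bound is phrased on duplicate-free lists, as are all sums over
    [V] below: an infinite sum is bounded by [B] when all its sums over
    duplicate-free lists are. *)
Definition level_growth (l : V -> V -> nat) (c D : R) :=
  forall x j (s : seq V), uniq s -> all (fun y => l x y <= j)%N s ->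
    (size s)%:R <= c * D ^+ j.

Lemma level_count l c D : level_growth l c D -> forall x j s, uniq s ->
  (count (fun y => l x y <= j)%N s)%:R <= c * D ^+ j.
Proof.
move=> gr x j s us; rewrite -size_filter; apply: (gr x); first exact: filter_uniq.
exact: filter_all.
Qed.

Lemma level_count_eq l c D : level_growth l c D -> forall x j s, uniq s ->
  (count (fun y => l x y == j)%N s)%:R <= c * D ^+ j.
Proof.
move=> gr x j s us; apply: le_trans (level_count gr x j us).
by rewrite ler_nat; apply: sub_count => y /eqP ->/=.
Qed.

Lemma seq_bound (f : V -> nat) (s : seq V) :
  exists n, forall y, y \in s -> (f y < n)%N.
Proof.
exists (\max_(y <- s) (f y)).+1 => y ys; rewrite ltnS.
by rewrite (big_rem y)//= leq_maxl.
Qed.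

Section exponents.
Context (l : V -> V -> nat) (a D c : R).
Hypotheses (lq : quasi_ultrametric l) (c0 : 0 < c) (a0 : 0 < a) (a1 : a < 1)
  (aD1 : 1 < a * D) (a4D3 : a ^+ 4 * D ^+ 3 < 1) (lgr : level_growth l c D).

(** [beta ^+ l x y] is the dyadic form of the distance to the power [d - 2
    alpha], the decay of the convolution of the Green function with itself. *)
Definition beta : R := a ^+ 2 * D.

Let D0 : 0 < D.
Proof. by have := lt_trans ltr01 aD1; rewrite pmulr_rgt0. Qed.

Lemma D_gt1 : 1 < D.
Proof. by apply: lt_le_trans aD1 _; rewrite ger_pMl ?ltW. Qed.

Lemma beta_gt0 : 0 < beta.
Proof. by rewrite /beta mulr_gt0// exprn_gt0. Qed.

Lemma Dbeta_gt1 : 1 < D * beta.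
Proof.
have -> : D * beta = (a * D) ^+ 2 by rewrite /beta; lra.
by rewrite exprn_egt1.
Qed.

Lemma Dbeta2_lt1 : D * beta ^+ 2 < 1.
Proof. by have -> : D * beta ^+ 2 = a ^+ 4 * D ^+ 3 by rewrite /beta; lra. Qed.

(** If [beta >= 1] then [D * beta ^+ 2 >= D * beta > 1]. *)
Lemma beta_lt1 : beta < 1.
Proof.
rewrite ltNge; apply/negP => b1; move: Dbeta2_lt1; rewrite ltNge => /negP; apply.
by rewrite (le_trans b1)// expr2 mulrA ler_peMl ?(ltW beta_gt0)// ltW// Dbeta_gt1.
Qed.

Lemma a_le_beta : a <= beta.
Proof. by rewrite /beta expr2 -mulrA ler_peMr ?ltW. Qed.

(** With [k = l x w], one of [l x y], [l y w] is at least [k - 1]. If the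
    smaller level is [j], the product is at most [a^(j + max(j, k - 1))], and
    there are at most [c D^j] points at level [j] from the corresponding end.
    The shells [j < k] form a growing geometric series of ratio [a D > 1], the
    shells [j >= k] a decreasing one of ratio [beta < 1], and both are of
    order [beta^k]. *)
Lemma green_convolution_le : exists2 Q : R, 0 < Q & forall x w s, uniq s ->
  \sum_(y <- s) a ^+ l x y * a ^+ l y w <= Q * beta ^+ l x w.
Proof.
pose Q1 := c * (a^-1 / (a * D - 1) + (1 - beta)^-1).
have Q10 : 0 < Q1.
  by rewrite mulr_gt0// addr_gt0// ?divr_gt0 ?invr_gt0 ?subr_gt0 ?beta_lt1.
exists (Q1 + Q1); first by rewrite addr_gt0.
move=> x w s us; set k := l x w.
pose phi j := a ^+ (j + maxn j k.-1).
have phi0 j : 0 <= phi j by rewrite exprn_ge0// ltW.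
have one v : \sum_(y <- s) phi (l v y) <= Q1 * beta ^+ k.
  have [n0 n0P] := seq_bound (l v) s.
  have nP y : y \in s -> (l v y < n0 + k)%N.
    by move=> /n0P /leq_trans; apply; rewrite leq_addr.
  apply: le_trans (sum_by_level_le phi0 nP
    (fun j _ => level_count_eq lgr v j us)) _.
  rewrite -(big_mkord xpredT (fun j => phi j * (c * D ^+ j))).
  rewrite (big_cat_nat (leq0n k) (leq_addl n0 k))/=.
  rewrite /Q1 -mulrA mulrDl mulrDr lerD//.
    rewrite big_nat.
    apply: (@le_trans _ _ (\sum_(0 <= j < k) (c * (a^-1 * a ^+ k)) * (a * D) ^+ j)).
      rewrite [leRHS]big_nat; apply: ler_sum => j /andP[_ jk].
      rewrite /phi (maxn_idPr _); last by lia.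
      have -> : k = k.-1.+1 by lia.
      rewrite /= exprD exprS exprMn mulKf ?gt_eqF// le_eqVlt; apply/orP; left.
      by apply/eqP; lra.
    rewrite -mulr_sumr -mulrA ler_wpM2l ?(ltW c0)// big_mkord.
    apply: le_trans (ler_wpM2l _ (geometric_growing_le k aD1)) _.
      by rewrite mulr_ge0 ?invr_ge0 ?exprn_ge0// ltW.
    have -> : beta ^+ k = a ^+ k * (a * D) ^+ k.
      by rewrite -exprMn /beta; congr (_ ^+ _); lra.
    by lra.
  apply: (@le_trans _ _ (\sum_(k <= j < n0 + k) c * beta ^+ j)).
    rewrite big_nat [leRHS]big_nat; apply: ler_sum => j /andP[kj _].
    rewrite /phi (maxn_idPl _); last by lia.
    rewrite /beta exprMn -exprM addnn -mul2n.
    by lra.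
  rewrite -mulr_sumr ler_wpM2l ?(ltW c0)// [leRHS]mulrC.
  by apply: geometric_tail_le; rewrite ?beta_lt1// ltW// beta_gt0.
apply: (@le_trans _ _ (\sum_(y <- s) (phi (l x y) + phi (l w y)))).
  apply: ler_sum => y _; rewrite -exprD (lq.1 y w).
  have := lq.2 y x w; rewrite (lq.1 y w) -/k => kP.
  have [xy|yx] := leqP (l x y) (l w y).
    rewrite -[leLHS]addr0 lerD// /phi.
    by apply: ler_wiXn2l; [exact: ltW|exact: ltW|lia].
  rewrite -[leLHS]add0r lerD// /phi.
  by apply: ler_wiXn2l; [exact: ltW|exact: ltW|lia].
by rewrite big_split/= mulrDl lerD.
Qed.

(** The so-called 3G inequality. The smaller of the two factors on the left is
    at most [a^-1 * a ^+ l x z], since the larger of their levels is at least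
    [l x z - 1], and the other factor is bounded by the sum. *)
Lemma green_triangle x y z :
  a ^+ l x y * a ^+ l y z <= a^-1 * a ^+ l x z * (a ^+ l x y + a ^+ l y z).
Proof.
have [ha ha1] := (ltW a0, ltW a1).
suff main p q r : (r <= (maxn p q).+1)%N -> (p <= q)%N ->
    a ^+ p * a ^+ q <= a^-1 * a ^+ r * (a ^+ p + a ^+ q).
  have := lq.2 y x z; case: (leqP (l x y) (l y z)) => [xy|/ltnW xy] h.
    by apply: main => //; lia.
  by rewrite mulrC [X in _ <= _ * X]addrC; apply: main => //; lia.
move=> rpq pq.
apply: (@le_trans _ _ (a^-1 * a ^+ r * a ^+ p)); last first.
  by rewrite ler_wpM2l ?mulr_ge0 ?invr_ge0 ?exprn_ge0// lerDl exprn_ge0.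
rewrite mulrC ler_wpM2r ?exprn_ge0// mulrC ler_pdivlMr// -exprSr.
by apply: ler_wiXn2l => //; lia.
Qed.

(** Expand the square over pairs [i], [j], replace [a^l(x,y) a^l(y, z i)] by
    means of [green_triangle], and sum over [y] by convolution: what
    multiplies [a ^+ l x (z i)] is then a potential seen from [x] or from [z
    i]. *)
Lemma green_square_le : exists2 Q : R, 0 < Q &
  forall (I : finType) (z : I -> V) (S : R),
  (forall v, \sum_i beta ^+ l v (z i) <= S) ->
  forall x s, uniq s ->
  \sum_(y <- s) a ^+ l x y * (\sum_i a ^+ l y (z i)) ^+ 2
    <= Q * S * \sum_i a ^+ l x (z i).
Proof.
have [Q Q0 QP] := green_convolution_le.
exists (a^-1 * (Q + Q)); first by rewrite mulr_gt0 ?addr_gt0 ?invr_gt0.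
move=> I z S SP x s us.
have a0' := ltW a0.
apply: (@le_trans _ _ (\sum_(y <- s) \sum_i \sum_j a^-1 * a ^+ l x (z i) *
   (a ^+ l x y * a ^+ l y (z j) + a ^+ l (z i) y * a ^+ l y (z j)))).
  apply: ler_sum => y _; rewrite expr2 mulr_suml mulr_sumr.
  apply: ler_sum => i _; rewrite mulr_sumr mulr_sumr.
  apply: ler_sum => j _; rewrite -mulrDl (lq.1 (z i)) !mulrA.
  by rewrite ler_wpM2r ?exprn_ge0// green_triangle.
rewrite exchange_big/= mulr_sumr; apply: ler_sum => i _.
rewrite exchange_big/=.
under eq_bigr do rewrite -mulr_sumr big_split/=.
apply: (@le_trans _ _ (\sum_j a^-1 * a ^+ l x (z i) *
   (Q * beta ^+ l x (z j) + Q * beta ^+ l (z i) (z j)))).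
  apply: ler_sum => j _; rewrite ler_wpM2l ?mulr_ge0 ?invr_ge0 ?exprn_ge0//.
  by rewrite lerD// QP.
rewrite -mulr_sumr big_split/= -!mulr_sumr.
have Sx := SP x; have Sz := SP (z i).
apply: (@le_trans _ _ (a^-1 * a ^+ l x (z i) * (Q * S + Q * S))).
  rewrite ler_wpM2l ?mulr_ge0 ?invr_ge0 ?exprn_ge0//.
  by rewrite lerD// ler_wpM2l// ltW.
by lra.
Qed.

Lemma potential_le (v : V) (F : nat -> R) s n :
  (forall y, y \in s -> l v y < n)%N ->
  (forall j, (j < n)%N -> (count (fun y => l v y <= j)%N s)%:R <= F j) ->
  \sum_(y <- s) beta ^+ l v y <= \sum_(j < n) beta ^+ j * F j.
Proof.
move=> sn sF; have b0 := ltW beta_gt0.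
apply: (sum_by_level_le (phi := fun j => beta ^+ j)) => // [k|k kn].
  exact: exprn_ge0.
apply: le_trans (sF _ kn).
by rewrite ler_nat; apply: sub_count => y /eqP ->/=.
Qed.

(** Only the shells up to level [j] grow; beyond level [j] the number of
    points stays at most [c D^j] while [beta^i] decays. *)
Lemma ball_potential_le : exists2 B : R, 0 < B & forall w j s, uniq s ->
  all (fun y => l w y <= j)%N s ->
  forall v, \sum_(y <- s) beta ^+ l v y <= B * (D * beta) ^+ j.
Proof.
have b0 := ltW beta_gt0; have b1 := beta_lt1.
exists (c * (D * beta / (D * beta - 1) + 1 / (1 - beta))).
  rewrite mulr_gt0// addr_gt0// divr_gt0 ?subr_gt0 ?Dbeta_gt1//.
  exact: lt_trans Dbeta_gt1.
move=> w j s us sj v.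
have [n0 n0P] := seq_bound (l v) s.
have nP y : y \in s -> (l v y < n0 + j.+1)%N.
  by move=> /n0P /leq_trans; apply; rewrite leq_addr.
pose F i := if (i < j.+1)%N then c * D ^+ i else c * D ^+ j.
apply: (le_trans (@potential_le v F s _ nP _)).
  move=> i _; rewrite /F; case: ifP => _; first exact: level_count.
  apply: le_trans (lgr us sj).
  by rewrite ler_nat count_size.
rewrite -(big_mkord xpredT (fun i => beta ^+ i * F i)).
rewrite (big_cat_nat (leq0n j.+1) (leq_addl n0 j.+1))/=.
rewrite -mulrA mulrDl mulrDr lerD//.
  apply: (@le_trans _ _ (\sum_(i < j.+1) c * (D * beta) ^+ i)).
    rewrite big_mkord; apply: ler_sum => i _; rewrite /F ltn_ord (exprMn _ D beta).
    by lra.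
  rewrite -mulr_sumr ler_wpM2l ?(ltW c0)//.
  rewrite (le_trans (geometric_growing_le _ Dbeta_gt1))// exprS.
  by rewrite mulrAC.
apply: (@le_trans _ _ (\sum_(j.+1 <= i < n0 + j.+1) c * D ^+ j * beta ^+ i)).
  rewrite big_nat [leRHS]big_nat; apply: ler_sum => i /andP[ji _].
  by rewrite /F ltnNge ji/= mulrC.
rewrite -mulr_sumr -mulrA ler_wpM2l ?(ltW c0)// (exprMn _ D) [leRHS]mulrC -mulrA.
rewrite ler_wpM2l ?exprn_ge0 ?(ltW D0)//.
rewrite (le_trans (geometric_tail_le _ _ b0 b1))// mul1r ler_wpM2r//.
  by rewrite invr_ge0 subr_ge0 ltW.
by apply: ler_wiXn2l => //; exact: ltW.
Qed.

(** Shell [j] contributes at most [c (a^2 D)^j = c beta^j]. *)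
Lemma green_tail_le : exists2 B : R, 0 < B & forall x m s, uniq s ->
  all (fun y => m < l x y)%N s ->
  \sum_(y <- s) a ^+ l x y * a ^+ l x y <= B * beta ^+ m.
Proof.
have b0 := ltW beta_gt0; have b1 := beta_lt1.
exists (c / (1 - beta)); first by rewrite divr_gt0 ?subr_gt0.
move=> x m s us /allP sm.
have [n nP] := seq_bound (l x) s.
pose phi j := if (m <= j)%N then a ^+ j * a ^+ j else 0 : R.
have phi0 k : 0 <= phi k.
  by rewrite /phi; case: ifP => // _; rewrite mulr_ge0// exprn_ge0// ltW.
apply: (@le_trans _ _ (\sum_(y <- s) phi (l x y))).
  rewrite big_seq [leRHS]big_seq; apply: ler_sum => y ys.
  by rewrite /phi (ltnW (sm _ ys)).
apply: le_trans (sum_by_level_le phi0 nP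
  (fun j _ => level_count_eq lgr x j us)) _.
rewrite -(big_mkord xpredT (fun j => phi j * (c * D ^+ j))).
apply: (@le_trans _ _ (\sum_(m <= j < n) c * beta ^+ j)); last first.
  rewrite -mulr_sumr -mulrA ler_wpM2l ?(ltW c0)// mulrC.
  exact: geometric_tail_le.
rewrite [leRHS](big_nat_widenl _ 0%N)//= [leRHS]big_mkcond/=.
apply: ler_sum => j _; rewrite /phi; case: ifP => _; last by rewrite mul0r.
rewrite /beta exprMn -exprD addnn -muln2 mulnC exprM.
by lra.
Qed.

Lemma seq_argmin (f : V -> nat) (s : seq V) y0 : y0 \in s ->
  exists2 z, z \in s & forall y, y \in s -> (f z <= f y)%N.
Proof.
elim: s y0 => // y1 s IH y0 _; case: s IH => [_|y2 s IH].
  by exists y1; rewrite ?mem_head// => y; rewrite inE => /eqP ->.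
have [z zs zmin] := IH y2 (mem_head _ _).
have [h|h] := leqP (f y1) (f z).
  exists y1; rewrite ?mem_head// => y; rewrite inE => /predU1P[->//|/zmin].
  exact: leq_trans.
exists z; first by rewrite inE zs orbT.
by move=> y; rewrite inE => /predU1P[->|/zmin//]; exact: ltnW.
Qed.

(** The set is compared with the full space up to level [m] and with the
    hypothesis beyond. The latter contributes [K beta^-m] times a geometric
    sum of ratio [D beta^2 < 1] started at [m], again of order [(D beta)^m].
    The hypothesis only concerns balls centred in the set; an arbitrary [v] is
    replaced by the nearest point of the set, at the cost of one level, that
    is, of a factor [beta^-1]. *)
Lemma clustered_potential_le : exists2 B : R, 1 <= B &
  forall o K m M s, 0 <= K -> uniq s -> all (fun y => l o y <= M)%N s ->
  (forall z j, z \in s -> (m < j <= M.+1 + m)%N ->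
     (count (fun y => l z y <= j)%N s)%:R <= K * beta^-1 ^+ m * (D * beta) ^+ j) ->
  forall v, \sum_(y <- s) beta ^+ l v y <= B * (1 + K) * (D * beta) ^+ m.
Proof.
have b0 := beta_gt0; have b1 := beta_lt1; have Db := Dbeta_gt1.
have Db2 := Dbeta2_lt1; have D0' := D0.
have b0' := ltW b0.
pose B1 := c * (D * beta / (D * beta - 1)); pose B2 := (1 - D * beta ^+ 2)^-1.
have B10 : 0 <= B1.
  rewrite /B1 mulr_ge0 ?(ltW c0)// divr_ge0 ?subr_ge0 ?(ltW Db)//.
  by rewrite mulr_ge0// ltW.
have B20 : 0 <= B2 by rewrite invr_ge0 subr_ge0 ltW.
exists (beta^-1 * (1 + B1 + B2)).
  rewrite mulrC ler_pdivlMr// mul1r; lra.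
move=> o K m M s K0 us sM sK.
have near z : z \in s ->
    \sum_(y <- s) beta ^+ l z y <= (1 + B1 + B2) * (1 + K) * (D * beta) ^+ m.
  move=> zs.
  have nP y : y \in s -> (l z y < M.+1 + m.+1)%N.
    move=> ys; have := lq.2 o z y; rewrite (lq.1 z o).
    by have := allP sM _ ys; have := allP sM _ zs => /=; clear; lia.
  pose F i := if (i < m.+1)%N then c * D ^+ i
    else K * beta^-1 ^+ m * (D * beta) ^+ i.
  apply: (le_trans (@potential_le z F s _ nP _)).
    move=> i iM; rewrite /F; case: ltnP => im; first exact: level_count.
    by apply: sK => //; move: im iM; clear; lia.
  rewrite -(big_mkord xpredT (fun i => beta ^+ i * F i)).
  rewrite (big_cat_nat (leq0n m.+1) (leq_addl _ m.+1))/=.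
  apply: (@le_trans _ _ (B1 * (D * beta) ^+ m + K * B2 * (D * beta) ^+ m)).
    apply: lerD.
      apply: (@le_trans _ _ (\sum_(i < m.+1) c * (D * beta) ^+ i)).
        rewrite big_mkord; apply: ler_sum => i _; rewrite /F ltn_ord (exprMn _ D beta).
        by lra.
      rewrite -mulr_sumr /B1 -mulrA ler_wpM2l ?(ltW c0)//.
      by rewrite (le_trans (geometric_growing_le _ Db))// exprS mulrAC.
    apply: (@le_trans _ _ (\sum_(m.+1 <= i < M.+1 + m.+1)
        K * beta^-1 ^+ m * (D * beta ^+ 2) ^+ i)).
      rewrite big_nat [leRHS]big_nat; apply: ler_sum => i /andP[mi _].
      rewrite /F ltnNge mi/= mulrCA ler_wpM2l//.
        by rewrite mulr_ge0// exprn_ge0// invr_ge0.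
      by rewrite -exprMn; have -> : beta * (D * beta) = D * beta ^+ 2 by lra.
    rewrite -mulr_sumr -mulrA -mulrA ler_wpM2l//.
    apply: le_trans (ler_wpM2l _ (geometric_tail_le _ _ _ Db2)) _.
    - by rewrite exprn_ge0// invr_ge0.
    - by rewrite mulr_ge0 ?exprn_ge0// ltW.
    rewrite mulrA [leRHS]mulrC ler_wpM2r// exprS mulrCA -exprMn.
    have -> : beta^-1 * (D * beta ^+ 2) = D * beta.
      by rewrite mulrC expr2 mulrA mulfK// gt_eqF.
    by rewrite ler_piMl ?(ltW Db2)// exprn_ge0// mulr_ge0// ltW.
  rewrite -mulrDl ler_wpM2r//; first by rewrite exprn_ge0// mulr_ge0// ltW.
  by nra.
move=> v; case: (posnP (size s)) => [/size0nil ->|].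
  rewrite big_nil !mulr_ge0 ?exprn_ge0 ?invr_ge0//; [lra|lra|].
  by rewrite mulr_ge0// ltW.
rewrite -has_predT => /hasP[y0 y0s _].
have [z zs zmin] := seq_argmin (l v) y0s.
apply: (@le_trans _ _ (\sum_(y <- s) beta^-1 * beta ^+ l z y)); last first.
  by rewrite -mulr_sumr -!mulrA ler_wpM2l ?invr_ge0// mulrA; exact: near.
rewrite big_seq [leRHS]big_seq; apply: ler_sum => y ys.
rewrite mulrC ler_pdivlMr// -exprSr.
apply: ler_wiXn2l => //; first exact: ltW.
by have := lq.2 v z y; rewrite (lq.1 z v); have := zmin _ ys; clear; lia.
Qed.

End exponents.
End level_sums.

(** * Finite graphs that branch *)

Section graph_constructions.
Variable V : choiceType.
Implicit Types (A B H : graph V) (x y : V).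

Fact filter_sym H (Q : rel V) : symmetric Q ->
  symmetric (fun u v => H u v && Q u v).
Proof. by move=> Qs u v; rewrite adj_sym Qs. Qed.

Fact filter_irr H (Q : rel V) : irreflexive (fun u v => H u v && Q u v).
Proof. by move=> u; rewrite adj_irr. Qed.

Definition edge_filter H (Q : rel V) (Qs : symmetric Q) : graph V :=
  Graph (filter_sym H Qs) (filter_irr H Q).

Lemma edge_filter_sub H Q (Qs : symmetric Q) : subgraph (edge_filter H Qs) H.
Proof. by move=> u v /= /andP[]. Qed.

Fact union_sym A B : symmetric (fun u v => A u v || B u v).
Proof. by move=> u v; rewrite !(adj_sym _ u). Qed.

Fact union_irr A B : irreflexive (fun u v => A u v || B u v).
Proof. by move=> u; rewrite !adj_irr. Qed.

Definition graph_union A B : graph V := Graph (@union_sym A B) (@union_irr A B).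

Fact avoid_sym x : symmetric (fun u v : V => (u != x) && (v != x)).
Proof. by move=> u v; rewrite andbC. Qed.

Definition isolate H x : graph V := edge_filter H (avoid_sym x).

Fact pair_sym x w :
  symmetric (fun u v : V => (u == x) && (v == w) || (u == w) && (v == x)).
Proof. by move=> u v; rewrite orbC; congr (_ || _); exact: andbC. Qed.

Definition one_edge H x w : graph V := edge_filter H (pair_sym x w).

Fact touch_sym (K : pred V) : symmetric (fun u v : V => K u || K v).
Proof. by move=> u v; rewrite orbC. Qed.

Fact miss_sym (K : pred V) : symmetric (fun u v : V => ~~ (K u || K v)).
Proof. by move=> u v; rewrite orbC. Qed.

Fact inside_sym (L : seq V) : symmetric (fun u v : V => (u \in L) && (v \in L)).
Proof. by move=> u v; rewrite andbC. Qed.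

Definition induced H (L : seq V) : graph V := edge_filter H (inside_sym L).

Lemma connected_refl H x : connected H x x.
Proof. by exists [::]. Qed.

Lemma connected_trans H y x z :
  connected H x y -> connected H y z -> connected H x z.
Proof.
move=> [p [xp <-]] [q [yq <-]]; exists (p ++ q).
by rewrite cat_path xp last_cat.
Qed.

Lemma connected_edge H x y : H x y -> connected H x y.
Proof. by move=> xy; exists [:: y]; rewrite /= xy. Qed.

Lemma connected_sub A B : subgraph A B -> forall x y,
  connected A x y -> connected B x y.
Proof.
by move=> AB x y [p [xp <-]]; exists p; split => //; apply: sub_path xp => u v /AB.
Qed.

Lemma path_connected H x p : path H x p ->
  forall u, u \in x :: p -> connected H x u.
Proof.
elim: p x => [|w p IH] x /=.
  by move=> _ u; rewrite inE => /eqP ->; exact: connected_refl.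
move=> /andP[xw wp] u; rewrite inE => /predU1P[->|up]; first exact: connected_refl.
exact: connected_trans (connected_edge xw) (IH _ wp _ up).
Qed.

Lemma path_isolate H x w p : x \notin w :: p -> path H w p ->
  path (isolate H x) w p.
Proof.
move=> xp; apply: (sub_in_path (P := [pred u | u != x])).
  by move=> u v; rewrite !inE /= => ux vx ->; rewrite ux vx.
by apply/allP => u up; rewrite inE; apply: contraNneq xp => <-.
Qed.

Lemma isolated H x y : connected (isolate H x) x y -> y = x.
Proof. by case=> -[|w p] [] //=; rewrite eqxx andbF. Qed.

Lemma isolate_sub H x : subgraph (isolate H x) H.
Proof. exact: edge_filter_sub. Qed.

Lemma connected_sym H x y : connected H x y -> connected H y x.
Proof.
case=> p [xp <-]; exists (rev (belast x p)); split.
  rewrite rev_path; apply: sub_path xp => u v uv; by rewrite adj_sym.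
case: p {xp} => //= w p; by rewrite rev_cons last_rcons.
Qed.

End graph_constructions.

Section branching.
Variable V : choiceType.
Implicit Types (A B H : graph V) (x y : V).
Variables (I : finType) (z : I -> V).
Implicit Types S : {set I}.

Definition connects x S : set (graph V) :=
  [set H | forall i, i \in S -> connected H x (z i)].

Definition is_split S (q : {set I} * {set I}) :=
  [&& q.1 :|: q.2 == S, [disjoint q.1 & q.2], q.1 != finset.set0
    & q.2 != finset.set0].

(** Walk along a simple path from [x] to one target. Delete the edges at [x]
    once it has been left. As long as all targets remain connected to the
    current point, go on with the shorter path. Otherwise the targets in the
    component of the next vertex and those outside it can be reached from [x]
    through disjoint sets of edges: those touching that component and the
    others. A walk that reaches its own target separates that target, reached
    by no edge at all, from the rest. *)
Lemma branch_graph p H x S i0 : path H x p -> uniq (x :: p) ->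
    last x p = z i0 -> i0 \in S -> connects x S H -> (1 < #|S|)%N ->
  exists y q A1 A2 A3, [/\ is_split S q, connected A1 x y, connects y q.1 A2,
    connects y q.2 A3 & [/\ subgraph A1 H, subgraph A2 H, subgraph A3 H,
    edge_disjoint A1 (graph_union A2 A3) & edge_disjoint A2 A3]].
Proof.
move=> + + + i0S; elim: p H x => [|w p IH] H x.
  move=> _ _ /= xz SH S1.
  (* The walk has reached its target [z i0 = x], which needs no edge. *)
  exists x, ([set i0]%SET, (S :\ i0)%SET), (empty_graph V), (empty_graph V), H; split => //=.
  - apply/and4P; split => /=; first by rewrite finset.setD1K.
    + by rewrite disjoints1 !inE eqxx.
    + by apply/set0Pn; exists i0; rewrite inE.
    + by rewrite -card_gt0; move: S1; rewrite (cardsD1 i0) i0S.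
  - exact: connected_refl.
  - by move=> i /=; rewrite inE => /eqP ->; rewrite -xz; exact: connected_refl.
  - by move=> i /=; rewrite !inE => /andP[_]; exact: SH.
  - by split => // u v [].
rewrite [path _ _ _]/= => /andP[xw wp] /andP[xwp uwp] lz SH S1.
have wp' := path_isolate xwp wp.
have wx : w != x by apply: contraNneq xwp => ->; rewrite mem_head.
set H' := isolate H x in wp'.
have [allw|] := pselect (connects w S H').
  have [y [q [A1 [A2 [A3 [qS A1y A2q A3q [s1 s2 s3 d1 d2]]]]]]] :=
    IH H' w wp' uwp lz allw S1.
  exists y, q, (graph_union (one_edge H x w) A1), A2, A3; split => //.
    apply: (@connected_trans _ _ w).
      by apply: connected_edge; rewrite /= xw !eqxx.
    by apply: connected_sub A1y => u v /= ->; rewrite orbT.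
  have H'H := @isolate_sub V H x.
  split => //; try by move=> u v /s2 /H'H || by move=> u v /s3 /H'H.
    by move=> u v /= /orP[/andP[]//|/s1/H'H].
  move=> u v [/= /orP[/andP[_ uv]|uv1] /orP uv23]; last first.
    by apply: (d1 u v); split => //; apply/orP.
  have : H' u v by case: uv23 => [/s2|/s3].
  by rewrite /H' /= => /and3P[_ ux vx]; move: uv; rewrite (negPf ux) (negPf vx) andbF.
move=> /existsNP[i1 /not_implyP[i1S wi1]].
(* Some target is not reached from [w] without [x]: split along the component
   [K] of [w] in [H']. It contains neither [x] nor that target. *)
pose K : pred V := fun u => `[< connected H' w u >].
have KP u v : connected H' u v -> K u = K v.
  move=> uv; apply: asbool_equiv_eq; split => h; first exact: connected_trans h uv.
  exact: connected_trans h (connected_sym uv).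
have Kw : K w by apply/asboolP; exact: connected_refl.
have Kx : ~~ K x.
  by apply/asboolPn => /connected_sym /isolated /eqP; rewrite (negPf wx).
exists x, ([set i in S | K (z i)]%SET, [set i in S | ~~ K (z i)]%SET), (empty_graph V).
exists (edge_filter H (touch_sym K)), (edge_filter H (miss_sym K)).
split => //=.
- apply/and4P; split => /=.
  + by apply/eqP/setP => i; rewrite !inE -andb_orr orbN andbT.
  + by rewrite -setI_eq0; apply/eqP/setP => i; rewrite !inE; case: (K (z i)); rewrite ?andbF.
  + apply/set0Pn; exists i0; rewrite inE i0S -lz /=.
    by rewrite -(KP w)//; exists p.
  + by apply/set0Pn; exists i1; rewrite inE i1S; apply/asboolPn.
- exact: connected_refl.
- move=> i; rewrite inE => /andP[iS /asboolP[r [wr wi]]].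
  apply: (@connected_trans _ _ w); first by apply: connected_edge; rewrite /= xw Kw orbT.
  exists r; split => //; apply: (sub_in_path (P := K)) (wr).
    by move=> u v Ku _ /andP[/= -> _]; rewrite (Ku : K u).
  by apply/allP => u /(path_connected wr) /KP <-.
- move=> i; rewrite inE => /andP[iS Ki].
  have [r0 [xr0 r0i]] := SH i iS.
  move: xr0 r0i; case/shortenP => r xr /andP[xnr ur] _ {r0} ri.
  case: r xr xnr ur ri => [|v r] /=.
    by move=> _ _ _ <-; exact: connected_refl.
  move=> /andP[xv vr] xnr _ ri.
  have vr' := path_isolate xnr vr.
  have Kv : ~~ K v by rewrite (KP v (z i))//; exists r.
  apply: (@connected_trans _ _ v).
    by apply: connected_edge; rewrite /= xv (negPf Kx) (negPf Kv).
  exists r; split => //; apply: (sub_in_path (P := predC K)) (vr').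
    move=> u1 u2 /= Ku1 Ku2 /andP[/= -> _].
    by rewrite (negPf (Ku1 : ~~ K u1)) (negPf (Ku2 : ~~ K u2)).
  by apply/allP => u /(path_connected vr') /KP /= <-.
- split => //; try exact: edge_filter_sub; first by move=> u v [].
  by move=> u v /= [/andP[_ ->] /andP[_]].
Qed.

Lemma finite_induced H (L : seq V) : finite_graph (induced H L).
Proof.
apply: (@sub_finite_set _ _ ([set` L] `*` [set` L])); last first.
  by apply: finite_setX; exact: finite_seq.
by move=> [u v] /= /and3P[_ ? ?].
Qed.

Lemma finite_connected H x y : connected H x y ->
  exists2 A, finite_graph A /\ subgraph A H & connected A x y.
Proof.
move=> [p [xp <-]]; exists (induced H (x :: p)).
  by split; [exact: finite_induced|exact: edge_filter_sub].
exists p; split => //; apply: (sub_in_path (P := mem (x :: p))) xp.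
  by move=> u v up vp uv; rewrite /= uv (up : u \in x :: p) (vp : v \in x :: p).
by apply/allP.
Qed.

Lemma finite_connects H x S : connects x S H ->
  exists2 A, finite_graph A /\ subgraph A H & connects x S A.
Proof.
move=> SH.
have /choice[p pP] : forall i, exists p, i \in S -> path H x p /\ last x p = z i.
  move=> i; case: (boolP (i \in S)) => [/SH[p ?]|_]; last by exists [::].
  by exists p.
pose L := x :: flatten [seq p i | i <- enum I].
exists (induced H L).
  by split; [exact: finite_induced|exact: edge_filter_sub].
move=> i /pP[xp pz]; exists (p i); split => //.
apply: (sub_in_path (P := mem L)) xp; first by move=> u v up vp uv; rewrite /= uv (up : u \in L) (vp : v \in L).
apply/allP => u; rewrite /L/= !inE => /predU1P[->|up]; first by rewrite eqxx.
by apply/orP; right; apply/flatten_mapP; exists i => //; rewrite mem_enum.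
Qed.

Lemma finite_graph_union A B :
  finite_graph A -> finite_graph B -> finite_graph (graph_union A B).
Proof.
move=> fA fB; apply: (@sub_finite_set _ _ ([set e | A e.1 e.2] `|` [set e | B e.1 e.2])).
  by move=> [u v] /= /orP[]; [left|right].
by rewrite finite_setU.
Qed.

Lemma increasing_connected x y : increasing [set H : graph V | connected H x y].
Proof. by move=> A B AB /=; exact: connected_sub. Qed.

Lemma increasing_connects x S : increasing (connects x S).
Proof. by move=> A B AB SA i /SA; exact: connected_sub. Qed.

Lemma increasing_disjoint_occurrence (E F : set (graph V)) :
  increasing (disjoint_occurrence E F).
Proof.
move=> A B AB [A1 [A2 [s1 s2 d w1 w2]]]; exists A1, A2; split => //.
  by move=> u v /s1/AB.
by move=> u v /s2/AB.
Qed.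

Lemma disjoint_occurrenceP (E F : set (graph V)) A B H : increasing E -> increasing F ->
  finite_graph A -> finite_graph B ->
  E A -> F B -> edge_disjoint A B -> subgraph A H -> subgraph B H ->
  disjoint_occurrence E F H.
Proof.
move=> iE iF fA fB EA FB AB AH BH; exists A, B; split => //; split => //.
  by move=> C /= /iE; apply.
by move=> C /= /iF; apply.
Qed.

(** The three edge-disjoint graphs of [branch_graph] may be infinite; each is
    cut down to the edges of finitely many paths. *)
Lemma connects_branch H x S : (1 < #|S|)%N -> connects x S H ->
  exists y q, is_split S q /\
    disjoint_occurrence [set H | connected H x y]
      (disjoint_occurrence (connects y q.1) (connects y q.2)) H.
Proof.
move=> S1 SH.
have /card_gt0P[i0 i0S] : (0 < #|S|)%N by exact: ltnW.
have [p0 [xp0 zp0]] := SH i0 i0S.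
move: xp0 zp0; case/shortenP => p xp up _ zp.
have [y [q [B1 [B2 [B3 [qS B1y B2q B3q [s1 s2 s3 d1 d2]]]]]]] :=
  branch_graph xp up zp i0S SH S1.
have [A1 [f1 t1] A1y] := finite_connected B1y.
have [A2 [f2 t2] A2q] := finite_connects B2q.
have [A3 [f3 t3] A3q] := finite_connects B3q.
exists y, q; split => //.
apply: (@disjoint_occurrenceP _ _ A1 (graph_union A2 A3)) => //.
- exact: increasing_connected.
- exact: increasing_disjoint_occurrence.
- exact: finite_graph_union.
- apply: (@disjoint_occurrenceP _ _ A2 A3) => //; try exact: increasing_connects.
  + by move=> u v [/t2 ? /t3 ?]; apply: (d2 u v).
  + by move=> u v /= ->.
  + by move=> u v /= ->; rewrite orbT.
- move=> u v [/t1 uv1 /= /orP uv23]; apply: (d1 u v); split => //=.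
  by case: uv23 => [/t2 ->//|/t3 ->]; rewrite orbT.
- by move=> u v /t1/s1.
- by move=> u v /= /orP[/t2/s2|/t3/s3].
Qed.

End branching.

(** * Inequalities between finite combinations of probabilities *)

Section weighted_bounds.
Context (R : realType) (d : measure_display) (T : measurableType d)
  (P : probability T R).

Definition prob (A : set T) : R := fine (P A).

Lemma probE A : measurable A -> P A = (prob A)%:E.
Proof. by move=> mA; rewrite /prob fineK// fin_num_measure. Qed.

Lemma prob_ge0 A : 0 <= prob A.
Proof. exact/fine_ge0/measure_ge0. Qed.

(** Integrate the pointwise inequality between combinations of indicators. *)
Lemma prob_weighted_le (J K : finType) (v : J -> R) (A : J -> set T)
    (w : K -> R) (E : K -> set T) :
  (forall j, 0 <= v j) -> (forall j, measurable (A j)) ->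
  (forall k, 0 <= w k) -> (forall k, measurable (E k)) ->
  (forall t, \sum_j v j * \1_(A j) t <= \sum_k w k * \1_(E k) t) ->
  \sum_j v j * prob (A j) <= \sum_k w k * prob (E k).
Proof.
move=> v0 mA w0 mE AE.
have int (I : finType) (u : I -> R) (B : I -> set T) :
    (forall i, 0 <= u i) -> (forall i, measurable (B i)) ->
    measurable_fun [set: T] (EFin \o (fun t => \sum_i u i * \1_(B i) t)) /\
    (\int[P]_t (\sum_i u i * \1_(B i) t)%:E)%E = (\sum_i u i * prob (B i))%:E.
  move=> u0 mB.
  have mi i : measurable_fun [set: T] (EFin \o (\1_(B i) : T -> R)).
    by apply/measurable_EFinP; exact: measurable_indic.
  have mui i : measurable_fun [set: T] (fun t => ((u i)%:E * (\1_(B i) t)%:E)%E).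
    by apply: emeasurable_funM => //; exact: mi.
  have eqt t : (\sum_i u i * \1_(B i) t)%:E = (\sum_i (u i)%:E * (\1_(B i) t)%:E)%E.
    by rewrite -sumEFin.
  split.
    rewrite (_ : _ \o _ = fun t => (\sum_i (u i)%:E * (\1_(B i) t)%:E)%E).
      exact: emeasurable_sum.
    by apply/funext => t /=; exact: eqt.
  under eq_integral do rewrite eqt.
  rewrite ge0_integral_sum//; last by move=> i t _; rewrite mule_ge0// lee_fin.
  rewrite -sumEFin; apply: eq_bigr => i _.
  rewrite ge0_integralZl//; last 2 first.
  - exact: mi.
  - exact: u0.
  by rewrite integral_indic// setIT EFinM -probE.
have [mfA iA] := int _ v A v0 mA; have [mfE iE] := int _ w E w0 mE.
rewrite -lee_fin -iA -iE; apply: ge0_le_integral => //.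
- by move=> t _; rewrite lee_fin sumr_ge0// => j _; rewrite mulr_ge0.
- by move=> t _; rewrite lee_fin.
Qed.

Lemma prob_scaled_le (J : finType) (w : J -> R) (E : J -> set T) (A : set T)
    (c : R) :
  0 <= c -> (forall j, 0 <= w j) -> measurable A ->
  (forall j, measurable (E j)) ->
  (forall t, A t -> c <= \sum_j w j * \1_(E j) t) ->
  c * prob A <= \sum_j w j * prob (E j).
Proof.
move=> c0 w0 mA mE AE.
have := @prob_weighted_le 'I_1 J (fun=> c) (fun=> A) w E.
rewrite big_ord1; apply => // t; rewrite big_ord1 indicE.
have [tA|tA] := boolP (t \in A); rewrite ?mulr1 ?mulr0.
  by apply: AE; rewrite inE in tA.
by apply: sumr_ge0 => j _; rewrite mulr_ge0.
Qed.

Lemma prob_finite_union_le (J : finType) (E : J -> set T) (A : set T) :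
  measurable A -> (forall j, measurable (E j)) ->
  (forall t, A t -> exists j, E j t) ->
  prob A <= \sum_j prob (E j).
Proof.
move=> mA mE AE; rewrite -[leLHS]mul1r; under eq_bigr do rewrite -[prob _]mul1r.
apply: prob_scaled_le => // t /AE[j Ejt].
rewrite (bigD1 j)//= indicE mem_set// mul1r lerDl.
by apply: sumr_ge0 => i _; rewrite mul1r indicE.
Qed.

(** Countable subadditivity for each [E j]; an injection of [V] into the
    natural numbers makes the partial sums of the series run over
    duplicate-free lists. The finitely many events are treated together so
    that the hypothesis may exchange the two sums. *)
Lemma prob_weighted_union_le (V : choiceType) (J : finType) (w : J -> R)
    (E : J -> set T) (F : J -> V -> set T) (B : R) :
  countable [set: V] ->
  (forall j, 0 <= w j) -> (forall j, measurable (E j)) ->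
  (forall j y, measurable (F j y)) ->
  (forall j t, E j t -> exists y, F j y t) ->
  (forall s, uniq s -> \sum_(y <- s) \sum_j w j * prob (F j y) <= B) ->
  \sum_j w j * prob (E j) <= B.
Proof.
move=> /countable_injP[f finj] w0 mE mF EF FB.
(* Partial inverse of an injection of [V] into the natural numbers, to index
   the union by them. *)
pose g n := if pselect (exists y, f y = n) is left h then Some (projT1 (cid h))
  else None.
have gK : ocancel g f by move=> n; rewrite /g; case: pselect => //= h; case: cid.
have fK y : g (f y) = Some y.
  rewrite /g; case: pselect => [h|[]]; last by exists y.
  by case: cid => y' /= /finj; rewrite !in_setT => ->.
pose F' j n := oapp (F j) set0 (g n).
have mF' j n : measurable (F' j n).
  by rewrite /F'; case: (g n) => [y|]/=.
have EF' j : (P (E j) <= \sum_(0 <= n <oo) P (F' j n))%E.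
  apply: measure_sigma_subadditive => // t /EF[y yt].
  by exists (f y) => //; rewrite /F' fK.
rewrite -lee_fin -sumEFin.
apply: (@le_trans _ _ (\sum_j (w j)%:E * \sum_(0 <= n <oo) P (F' j n))%E).
  apply: lee_sum => j _; rewrite EFinM -probE//.
  by apply: lee_wpmul2l => //; rewrite lee_fin.
under eq_bigr do rewrite -nneseriesZl//.
rewrite -nneseries_sum//; last first.
  by move=> j n _; rewrite mule_ge0// lee_fin.
apply: lime_le.
  apply: is_cvg_nneseries => n _ _; apply: sume_ge0 => j _.
  by rewrite mule_ge0// lee_fin.
apply: nearW => n.
have := FB (pmap g (iota 0 n)) (pmap_uniq gK (iota_uniq 0 n)).
rewrite -lee_fin; apply: le_trans.
under eq_bigr do under eq_bigr do rewrite probE// -EFinM.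
under eq_bigr do rewrite sumEFin.
rewrite sumEFin lee_fin /index_iota subn0.
elim: (iota 0 n) => [|k s IH]; first by rewrite !big_nil.
rewrite big_cons /=; rewrite {1}/F'.
case: (g k) => [y|] /=; rewrite ?big_cons; first by rewrite lerD2l.
by rewrite big1 ?add0r// => j _; rewrite /prob measure0 mulr0.
Qed.

End weighted_bounds.

(** * Measurability of connection events *)

Section graph_events.
Variable V : choiceType.
Hypothesis cV : countable [set: V].

Let countable_seq (T : Type) : countable [set: T] -> countable [set: seq T].
Proof. by move=> /Pcountable[T' ->]. Qed.

Lemma measurable_adj x y : measurable [set H : graph_space V | H x y].
Proof. by apply: sub_sigma_algebra; exists (x, y). Qed.

Lemma measurable_exists (I : Type) (F : I -> set (graph_space V)) :
  countable [set: I] -> (forall i, measurable (F i)) ->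
  measurable [set H | exists i, F i H].
Proof.
move=> cI mF; rewrite (_ : [set H | _] = \bigcup_i F i).
  exact: countable_bigcupT_measurable.
by apply/seteqP; split => H [i]; [exists i|exists i].
Qed.

Lemma measurable_const (Q : Prop) : measurable [set H : graph_space V | Q].
Proof.
have [q|q] := pselect Q.
  by rewrite (_ : [set H | _] = setT)//; apply/seteqP; split.
by rewrite (_ : [set H | _] = set0)//; apply/seteqP; split.
Qed.

Lemma measurable_connected x y :
  measurable [set H : graph_space V | connected H x y].
Proof.
apply: (@measurable_exists (seq V)
  (fun p => [set H : graph_space V | path H x p /\ last x p = y])).
  exact: countable_seq.
move=> p; have mp u : measurable [set H : graph_space V | path H u p].
  elim: p u => [|v p IH] u /=; first exact: measurable_const.
  rewrite (_ : [set H | _] =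
    [set H : graph_space V | H u v] `&` [set H : graph_space V | path H v p]).
    by apply: measurableI; [exact: measurable_adj|exact: IH].
  by apply/seteqP; split => H /= => [/andP[]|[-> ->]].
rewrite (_ : [set H | _] =
  [set H : graph_space V | path H x p] `&` [set H | last x p = y]).
  by apply: measurableI => //; exact: measurable_const.
by apply/seteqP; split.
Qed.

Lemma measurable_contains (s : seq (V * V)) :
  measurable [set H : graph_space V | all (fun e => H e.1 e.2) s].
Proof.
elim: s => [|e s IH] /=; first exact: measurable_const.
rewrite (_ : [set H | _] = [set H : graph_space V | H e.1 e.2] `&`
    [set H : graph_space V | all (fun e => H e.1 e.2) s]).
  by apply: measurableI => //; exact: measurable_adj.
by apply/seteqP; split => H /= => [/andP[]|[-> ->]].
Qed.

(** Witnesses are finite, so the event is a union, over the countably many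
    pairs of finite edge lists that form disjoint witnesses, of the events
    that both lists are present. *)
Lemma measurable_disjoint_occurrence (E F : set (graph_space V)) :
  measurable (disjoint_occurrence E F : set (graph_space V)).
Proof.
pose edges (A : graph V) (s : seq (V * V)) := forall u v, A u v = ((u, v) \in s).
pose ok (q : seq (V * V) * seq (V * V)) := exists A B : graph V,
  [/\ edges A q.1, edges B q.2, edge_disjoint A B,
   witnesses A E & witnesses B F].
pose X q := [set H : graph_space V | ok q] `&`
   ([set H : graph_space V | all (fun e => H e.1 e.2) q.1] `&`
    [set H : graph_space V | all (fun e => H e.1 e.2) q.2]).
have eqv (A H : graph V) s : edges A s -> subgraph A H <-> all (fun e => H e.1 e.2) s.
  move=> As; split => [AH|/allP h u v].
    by apply/allP => -[u v] uvs; apply: AH; rewrite As.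
  by rewrite As => /h.
rewrite (_ : disjoint_occurrence E F = [set H | exists q, X q H]).
  apply: measurable_exists.
    apply: (@sub_countable _ _ _ ([set: seq (V * V)] `*` [set: seq (V * V)])).
      by apply: subset_card_le.
    have cVV : countable [set: V * V].
      by rewrite -setXTT; exact: countableX.
    by apply: countableX; exact: countable_seq.
  move=> q; apply: measurableI; first exact: measurable_const.
  by apply: measurableI; exact: measurable_contains.
have fin (A : graph V) : finite_graph A -> exists s, edges A s.
  move=> /finite_seqP[s sE]; exists s => u v.
  have /= h := congr1 (fun S : set (V * V) => S (u, v)) sE.
  by apply/idP/idP; rewrite h.
apply/seteqP; split => H.
  move=> [A [B [AH BH AB wA wB]]].
  have [[s As] [t Bt]] := (fin A wA.1, fin B wB.1).
  exists (s, t); split; first by exists A, B.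
  by split => /=; [exact/(eqv A)|exact/(eqv B)].
move=> [[s t] [[A [B [As Bt AB wA wB]]] [/= sH tH]]].
by exists A, B; split => //; [exact/(eqv A H s)|exact/(eqv B H t)].
Qed.

Lemma measurable_connects (I : finType) (z : I -> V) x (S : {set I}) :
  measurable (connects z x S : set (graph_space V)).
Proof.
rewrite (_ : connects z x S = \bigcap_(i in [set` S])
   [set H : graph_space V | connected H x (z i)]); last first.
  by apply/seteqP; split => H h i; exact: h.
apply: fin_bigcap_measurable => // i _; exact: measurable_connected.
Qed.

End graph_events.

(** * The tree-graph bound for one cluster *)

(** Expansion of the product of the factors [1 + x], one for each element of
    [T]. *)
Lemma sum_subsets (R : comPzRingType) (I : finType) (T : {set I}) (x : R) :
  \sum_(S : {set I} | S \subset T) x ^+ #|S| = (1 + x) ^+ #|T|.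
Proof.
have -> : (1 + x) ^+ #|T| = \prod_(i : I) ((if i \in T then x else 0) + 1).
  rewrite -prodr_const big_mkcond/=; apply: eq_bigr => i _.
  by case: (i \in T); rewrite ?add0r// addrC.
rewrite bigA_distr big_mkcond/=; apply: eq_big => // S _.
case: ifPn => [ST|/subsetPn[i iS iT]].
  rewrite -prodr_const big_mkcond/=; apply: eq_bigr => i _.
  by case: ifPn => // /(fintype.subsetP ST) ->.
by rewrite (bigD1 i)//= iS (negPf iT) mul0r.
Qed.

Section tree_graph.
Context (R : realType) (V : choiceType) (cV : countable [set: V])
  (dT : measure_display) (T : measurableType dT) (P : probability T R)
  (G : {mfun T >-> graph_space V}) (BK : BK_inequality P G).

Lemma measurable_graph_event (E : set (graph_space V)) :
  measurable E -> measurable (G @^-1` E).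
Proof. by move=> mE; rewrite -[X in measurable X]setTI; exact: measurable_funP. Qed.

Lemma measurable_graph_connected x y :
  measurable [set w | connected (G w) x y].
Proof. exact: (measurable_graph_event (measurable_connected cV x y)). Qed.

Lemma BK_prob (E F : set (graph_space V)) : measurable E -> measurable F ->
  increasing E -> increasing F ->
  prob P (G @^-1` disjoint_occurrence E F)
    <= prob P (G @^-1` E) * prob P (G @^-1` F).
Proof.
move=> mE mF iE iF; rewrite -lee_fin EFinM -!probE; first exact: BK.
- exact: measurable_graph_event.
- exact: measurable_graph_event.
- by apply: measurable_graph_event; exact: measurable_disjoint_occurrence.
Qed.

Definition two_point x y : R := prob P [set w | connected (G w) x y].

Variables (I : finType) (z : I -> V).
Implicit Types S : {set I}.

Definition many_point x S : R := prob P (G @^-1` connects z x S).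

Lemma many_point_ge0 x S : 0 <= many_point x S.
Proof. exact: prob_ge0. Qed.

Lemma many_point1 x i : many_point x [set i]%SET = two_point x (z i).
Proof.
congr prob; apply/seteqP; split => w h /=; first by apply: h; rewrite inE.
by move=> j; rewrite inE => /eqP ->.
Qed.

(** Without the bound [n] this is the expectation of [(1 + theta)^N - 1],
    where [N] is the number of targets connected to [x]. The truncation turns
    the nonlinear inequality satisfied by the full function into a recursion.
    *)
Definition subset_gf (theta : R) n x : R :=
  \sum_(S : {set I} | (0 < #|S| <= n)%N) theta ^+ #|S| * many_point x S.

Variable theta : R.
Hypothesis theta0 : 0 <= theta.

Lemma subset_gf_ge0 n x : 0 <= subset_gf theta n x.
Proof.
by apply: sumr_ge0 => S _; rewrite mulr_ge0 ?exprn_ge0 ?many_point_ge0.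
Qed.

Lemma branch_event_prob x y (q : {set I} * {set I}) :
  prob P (G @^-1` disjoint_occurrence [set H | connected H x y]
     (disjoint_occurrence (connects z y q.1) (connects z y q.2)))
  <= two_point x y * (many_point y q.1 * many_point y q.2).
Proof.
apply: (@le_trans _ _ (two_point x y * prob P (G @^-1`
    disjoint_occurrence (connects z y q.1) (connects z y q.2)))).
  apply: BK_prob.
  - exact: measurable_connected.
  - exact: measurable_disjoint_occurrence.
  - exact: increasing_connected.
  - exact: increasing_disjoint_occurrence.
rewrite ler_wpM2l ?prob_ge0//; apply: BK_prob; try exact: measurable_connects;
  exact: increasing_connects.
Qed.

(** A disjoint pair of sets determines its union, and [theta ^+ #|S|] factors
    over the pair. In a split of a set of size at most [n + 1] both parts have
    size at most [n]. *)
Lemma subset_gf_branch n y :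
  \sum_(S : {set I} | (1 < #|S| <= n.+1)%N)
    \sum_(q | is_split S q) theta ^+ #|S| * (many_point y q.1 * many_point y q.2)
  <= subset_gf theta n y ^+ 2.
Proof.
rewrite expr2 big_distrlr/= pair_big/=.
rewrite (exchange_big_dep xpredT)//= [leRHS]big_mkcond/=.
apply: ler_sum => -[q1 q2] _ /=.
have t0 S : 0 <= theta ^+ #|S| * many_point y S.
  by rewrite mulr_ge0 ?exprn_ge0 ?many_point_ge0.
rewrite (eq_bigl (fun S => (S == q1 :|: q2) &&
    ((1 < #|S| <= n.+1)%N && is_split S (q1, q2)))); last first.
  by move=> S; rewrite /is_split/= eq_sym; case: (S == _); rewrite ?andbF.
rewrite big_mkcondr big_pred1_eq.
case: ifPn => [/andP[/andP[S1 Sn] /and4P[_ /= q12 n1 n2]]|_]; last first.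
  by case: ifP => // _; exact: mulr_ge0.
have qS : (#|q1 :|: q2| = #|q1| + #|q2|)%N.
  have q0 : q1 :&: q2 = finset.set0.
    by apply/eqP; rewrite finset.setI_eq0; exact: q12.
  by rewrite finset.cardsU q0 cards0 subn0.
rewrite -!card_gt0 in n1 n2; rewrite n1 n2 /=.
have [-> ->] : (#|q1| <= n)%N /\ (#|q2| <= n)%N by lia.
by rewrite qS exprD mulrACA.
Qed.

(** Single targets give the linear term. A set of at least two targets
    branches at some [y]; by the BK inequality the three disjoint connections
    cost at most a product, two factors of which are the same problem started
    at [y]. *)
Lemma subset_gf_step n x (B : R) :
  (forall s, uniq s ->
    \sum_(y <- s) two_point x y * subset_gf theta n y ^+ 2 <= B) ->
  subset_gf theta n.+1 x <= theta * \sum_i two_point x (z i) + B.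
Proof.
move=> sB; rewrite /subset_gf (bigID (fun S : {set I} => #|S| == 1%N))/= lerD//.
  rewrite (eq_bigl (fun S : {set I} => #|S| == 1%N)); last first.
    by move=> S; case: eqP => [->|_]; rewrite ?andbF.
  rewrite (eq_bigl (fun S => S \in [set [set i]%SET | i in I]%SET)); last first.
    move=> S; apply/cards1P/imsetP => [[i ->]|[i _ ->]]; first by exists i.
    by exists i.
  rewrite big_imset/=; last by move=> i j _ _; exact: finset.set1_inj.
  rewrite mulr_sumr; apply: ler_sum => i _.
  by rewrite cards1 expr1 many_point1.
rewrite (eq_bigl (fun S : {set I} => (1 < #|S| <= n.+1)%N)); last first.
  by move=> S; case: #|S| => [|[|k]]; rewrite ?andbF ?andbT.
(* The union bound is taken simultaneously for all sets of targets, with a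
   null weight on those that are not concerned. *)
pose w S := if (1 < #|S| <= n.+1)%N then theta ^+ #|S| else 0.
have w0 S : 0 <= w S by rewrite /w; case: ifP; rewrite ?exprn_ge0.
rewrite big_mkcond/=.
rewrite (eq_bigr (fun S => w S * prob P (if (1 < #|S| <= n.+1)%N
   then G @^-1` connects z x S else set0))); last first.
  by move=> S _; rewrite /w; case: ifP; rewrite ?mul0r.
pose D y q := G @^-1` disjoint_occurrence [set H | connected H x y]
     (disjoint_occurrence (connects z y q.1) (connects z y q.2)).
pose F S y := \bigcup_(q in [set q | is_split S q]) D y q.
have mD y q : measurable (D y q).
  by apply: measurable_graph_event; exact: measurable_disjoint_occurrence.
have mF S y : measurable (F S y).
  by apply: fin_bigcup_measurable => //; exact: finite_finset.
apply: (@prob_weighted_union_le _ _ _ P V _ _ _ F) => //.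
- move=> S; case: ifP => // _; apply: measurable_graph_event.
  exact: measurable_connects.
- move=> S t; case: ifP => // /andP[S1 _] /(connects_branch S1)[y [q [qS Dq]]].
  by exists y, q.
- move=> s us; apply: le_trans (sB s us); apply: ler_sum => y _.
  apply: (@le_trans _ _ (two_point x y *
    \sum_(S : {set I} | (1 < #|S| <= n.+1)%N) \sum_(q | is_split S q)
      theta ^+ #|S| * (many_point y q.1 * many_point y q.2))); last first.
    by rewrite ler_wpM2l ?prob_ge0// subset_gf_branch.
  rewrite mulr_sumr [leRHS]big_mkcond/=; apply: ler_sum => S _.
  rewrite /w; case: ifP => _; last by rewrite mul0r.
  apply: (@le_trans _ _ (theta ^+ #|S| * \sum_(q | is_split S q)
      two_point x y * (many_point y q.1 * many_point y q.2))); last first.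
    rewrite !mulr_sumr; apply: ler_sum => q _.
    by lra.
  rewrite ler_wpM2l ?exprn_ge0// big_mkcond/=.
  apply: (@le_trans _ _ (\sum_q prob P (if is_split S q then D y q else set0))).
    apply: prob_finite_union_le => //.
      by move=> q; case: ifP.
    by move=> t [q /= qS Dq]; exists q; rewrite qS.
  apply: ler_sum => q _; case: ifP => _; last by rewrite /prob measure0.
  exact: branch_event_prob.
Qed.

(** The sum [1 + subset_gf] over all sets of targets is the expectation of [(1
    + theta)^count], and [exp (theta / 2) <= 1 + theta] for [theta <= 1]. *)
Lemma count_connected_tail x (t : R) : theta <= 1 ->
  expR (theta * t / 2) *
    prob P [set w | t <= #|[set i | `[< connected (G w) x (z i) >]]%SET|%:R]
  <= 1 + subset_gf theta #|I| x.
Proof.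
move=> theta1.
have -> : 1 + subset_gf theta #|I| x =
    \sum_(S : {set I}) theta ^+ #|S| * many_point x S.
  rewrite (bigD1 finset.set0)//= cards0 expr0 mul1r; congr (_ + _).
    rewrite /many_point (_ : _ @^-1` _ = setT) ?/prob ?probability_setT//.
    by apply/seteqP; split => // w _ i; rewrite inE.
  apply: eq_bigl => S; rewrite -card_gt0 max_card andbT//.
have connE w (S : {set I}) : (G @^-1` connects z x S) w <->
    S \subset [set i | `[< connected (G w) x (z i) >]]%SET.
  split => [h|/fintype.subsetP h i /h]; last by rewrite inE => /asboolP.
  by apply/fintype.subsetP => i /h ?; rewrite inE; apply/asboolP.
apply: prob_scaled_le.
- exact: expR_ge0.
- by move=> S; rewrite exprn_ge0.
- rewrite (_ : [set w | _] = \bigcup_(S in [set S : {set I} | t <= #|S|%:R])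
     (G @^-1` connects z x S)).
    apply: fin_bigcup_measurable; first exact: finite_finset.
    by move=> S _; apply: measurable_graph_event; exact: measurable_connects.
  apply/seteqP; split => w /=.
    move=> tw; exists [set i | `[< connected (G w) x (z i) >]]%SET => //=.
    by apply/connE.
  move=> [S /= tS /connE SG]; apply: le_trans tS _.
  by rewrite ler_nat subset_leq_card.
- by move=> S; apply: measurable_graph_event; exact: measurable_connects.
move=> w /= tw; set U := [set i | _]%SET in tw *.
rewrite (_ : \sum_(S : {set I}) _ = (1 + theta) ^+ #|U|); last first.
  rewrite -sum_subsets [RHS]big_mkcond/=; apply: eq_bigr => S _.
  rewrite indicE; case: ifPn => [SU|/negP SU].
    by rewrite mem_set ?mulr1//; apply/connE.
  by rewrite memNset ?mulr0// => /connE.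
have e1 : expR (theta / 2) <= 1 + theta.
  have h : 1 - theta / 2 <= expR (- (theta / 2)) by exact: expR_ge1Dx.
  have e0 := expR_gt0 (theta / 2).
  have eN : expR (theta / 2) * expR (- (theta / 2)) = 1 by rewrite -expRD subrr expR0.
  have h2 : expR (theta / 2) * (1 - theta / 2) <= 1 by rewrite -[leRHS]eN ler_wpM2l// ltW.
  by have := theta0; have := theta1; nra.
apply: (@le_trans _ _ (expR (theta / 2) ^+ #|U|)).
  rewrite -expRM_natl ler_expR.
  by rewrite mulrAC mulrC ler_wpM2r// divr_ge0.
by apply: lerXn2r; rewrite ?nnegrE ?expR_ge0 ?addr_ge0.
Qed.

End tree_graph.

Section cluster_tail.
Context (R : realType) (V : choiceType) (cV : countable [set: V])
  (dT : measure_display) (T : measurableType dT) (P : probability T R)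
  (G : {mfun T >-> graph_space V}) (BK : BK_inequality P G)
  (l : V -> V -> nat) (a D c C : R).
Hypotheses (lq : quasi_ultrametric l) (c0 : 0 < c) (a0 : 0 < a) (a1 : a < 1)
  (aD1 : 1 < a * D) (a4D3 : a ^+ 4 * D ^+ 3 < 1) (lgr : level_growth l c D)
  (Cpos : 0 < C) (tau_le : forall x y, two_point P G x y <= C * a ^+ l x y).

Local Notation beta := (beta a D).

(** Take [theta = 1 / (K S)] and [h] the sum of [a ^+ l x (z i)]. If the
    generating function is at most [2 theta C h], the quadratic term of
    [subset_gf_step] is at most [4 theta^2 C^3 Q S h <= theta C h], so the
    bound reproduces itself; and [2 theta C h <= 1] because [h <= S]. *)
Lemma cluster_count_tail : exists2 k : R, 0 < k &
  forall (s : seq V) (S : R), 1 <= S ->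
    (forall v, \sum_(y <- s) beta ^+ l v y <= S) ->
  forall x t, prob P [set w | t <= (count (fun y => `[< connected (G w) x y >]) s)%:R]
    <= 2 * expR (- (k * t / S)).
Proof.
have [Q Q0 QP] := green_square_le lq c0 a0 a1 aD1 a4D3 lgr.
pose K := 4 * C ^+ 2 * Q + 2 * C + 1.
have CC : 0 < C ^+ 2 * Q by rewrite mulr_gt0// exprn_gt0.
have K0 : 0 < K by rewrite /K; have := Cpos; lra.
have K1 : 1 <= K by rewrite /K; have := Cpos; lra.
exists (2 * K)^-1; first by rewrite invr_gt0 mulr_gt0.
move=> s S S1 SP x t.
have S0 : 0 < S by exact: lt_le_trans S1.
pose I := 'I_(size s); pose z : I -> V := tnth (in_tuple s).
pose theta := (K * S)^-1.
have KS : 0 < K * S by rewrite mulr_gt0.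
have th0 : 0 <= theta by rewrite invr_ge0 ltW.
have thKS : theta * K * S = 1 by rewrite /theta -mulrA mulVf// gt_eqF.
have th1 : theta <= 1 by rewrite invf_le1//; nra.
have zP v : \sum_i beta ^+ l v (z i) <= S.
  by have := SP v; rewrite (big_tnth _ _ s).
pose h y := \sum_i a ^+ l y (z i).
have h0 y : 0 <= h y by apply: sumr_ge0 => i _; rewrite exprn_ge0// ltW.
have gf_le n y : subset_gf P G z theta n y <= 2 * theta * C * h y.
  elim: n y => [|n IH] y.
    rewrite /subset_gf big_pred0 ?mulr_ge0 ?(ltW Cpos)//.
    by move=> A; case: #|A|.
  have step u : uniq u -> \sum_(v <- u) two_point P G y v *
      subset_gf P G z theta n v ^+ 2 <= theta * C * h y.
    move=> uu.
    apply: (@le_trans _ _ (\sum_(v <- u) (4 * theta ^+ 2 * C ^+ 3) *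
        (a ^+ l y v * h v ^+ 2))).
      apply: ler_sum => v _.
      apply: (@le_trans _ _ (C * a ^+ l y v * (2 * theta * C * h v) ^+ 2)).
        apply: ler_pM; rewrite ?prob_ge0 ?exprn_ge0 ?subset_gf_ge0//.
        by apply: lerXn2r; rewrite ?nnegrE ?subset_gf_ge0 ?mulr_ge0 ?(ltW Cpos).
      by lra.
    rewrite -mulr_sumr.
    apply: (@le_trans _ _ ((4 * theta ^+ 2 * C ^+ 3) * (Q * S * h y))).
      rewrite ler_wpM2l ?mulr_ge0 ?exprn_ge0 ?(ltW Cpos)//.
      by apply: QP.
    have k4 : theta * (4 * C ^+ 2 * Q * S) <= 1.
      by rewrite -[leRHS]thKS -[leRHS]mulrA ler_wpM2l// ler_wpM2r ?(ltW S0)// /K; have := Cpos; lra.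
    have -> : 4 * theta ^+ 2 * C ^+ 3 * (Q * S * h y) =
       (theta * C * h y) * (theta * (4 * C ^+ 2 * Q * S)) by lra.
    by rewrite ler_piMr// !mulr_ge0// ltW.
  apply: (le_trans (subset_gf_step cV BK th0 step)).
  have -> : 2 * theta * C * h y = theta * (C * h y) + theta * C * h y by lra.
  rewrite lerD2r ler_wpM2l// mulr_sumr; exact: ler_sum.
have := count_connected_tail cV P G z th0 x t th1.
have := gf_le #|I| x; set gf := subset_gf _ _ _ _ _ _ => gfx.
have hS : h x <= S.
  apply: le_trans (zP x); apply: ler_sum => i _.
  by apply: lerXn2r; rewrite ?nnegrE ?(ltW (beta_gt0 a0 aD1)) ?(ltW a0)// a_le_beta.
have gf1 : gf <= 1.
  apply: le_trans gfx _.
  apply: (@le_trans _ _ (theta * (2 * C) * S)).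
    have -> : 2 * theta * C * h x = theta * (2 * C) * h x by lra.
    by rewrite ler_wpM2l// !mulr_ge0// ltW.
  rewrite -[leRHS]thKS ler_wpM2r ?(ltW S0)// ler_wpM2l// /K.
  by lra.
have -> : [set w | t <= #|[set i | `[< connected (G w) x (z i) >]]%SET|%:R] =
    [set w | t <= (count (fun y => `[< connected (G w) x y >]) s)%:R].
  apply/seteqP; split => w /=; rewrite cardsE -sum1_card -sum1_count (big_tnth _ _ s)//.
move=> ep.
have -> : (2 * K)^-1 * t / S = theta * t / 2.
  by rewrite /theta !invfM; lra.
rewrite expRN ler_pdivlMr ?expR_gt0// mulrC.
by apply: le_trans ep _; lra.
Qed.

End cluster_tail.

(** * Two independent clusters *)

Section counting_lists.
Context (R : realType) (V : choiceType).

Lemma counting_uniq (X : set V) (s : seq V) : uniq s -> X `<=` [set` s] ->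
  counting X = (count (fun y => `[< X y >]) s)%:R%:E :> \bar R.
Proof.
move=> us Xs; have fX : finite_set X by apply: sub_finite_set Xs _; exact: finite_seq.
rewrite /counting asboolT//; congr (_%:R%:E).
rewrite -size_filter; apply/perm_size/uniq_perm.
- exact: finmap.fset_uniq.
- exact: filter_uniq.
move=> y; rewrite in_fset_set// mem_filter.
apply/idP/andP => [|[/asboolP Xy _]]; rewrite inE// => Xy.
by split => //; exact: Xs.
Qed.

Lemma counting_value (X : set V) :
  counting X = +oo%E :> \bar R \/ exists n : nat, counting X = n%:R%:E :> \bar R.
Proof.
by rewrite /counting; case: ifP => _; [right; eexists|left].
Qed.

Lemma counting_le_finite (X : set V) (r : R) :
  (counting X <= r%:E)%E -> finite_set X.
Proof. by rewrite /counting; case: asboolP => //; rewrite leye_eq. Qed.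

Lemma counting_le_size (X : set V) (s : seq V) (r : R) :
  uniq s -> (forall y, y \in s -> X y) -> (counting X <= r%:E)%E ->
  (size s)%:R <= r.
Proof.
move=> us sX Xr; have fX := counting_le_finite Xr.
move: Xr; rewrite /counting asboolT// lee_fin; apply: le_trans.
rewrite ler_nat; apply: uniq_leq_size => // y ys.
by rewrite in_fset_set// inE; exact: sX.
Qed.

End counting_lists.

Section traces.
Variable V : choiceType.
Implicit Types (X : set V) (s : seq V).

(** Events that only look at a trace are determined by finitely many
    coordinates. *)
Definition trace X s : seq V := [seq y <- s | `[< X y >]].

Lemma measurable_mem y : measurable [set X : subset_space V | X y].
Proof. by apply: sub_sigma_algebra; exists y. Qed.

Lemma measurable_pattern s (Q : seq bool -> Prop) :
  measurable [set X : subset_space V | Q [seq `[< X y >] | y <- s]].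
Proof.
elim: s Q => [|y s IH] Q /=.
  have [q|q] := pselect (Q [::]).
    by rewrite (_ : [set X | _] = setT)//; apply/seteqP; split.
  by rewrite (_ : [set X | _] = set0)//; apply/seteqP; split.
rewrite (_ : [set X | _] =
  ([set X | X y] `&` [set X | Q (true :: [seq `[< X y >] | y <- s])]) `|`
  (~` [set X | X y] `&` [set X | Q (false :: [seq `[< X y >] | y <- s])])).
  apply: measurableU; apply: measurableI.
  - exact: measurable_mem.
  - exact: (IH (fun u => Q (true :: u))).
  - by apply: measurableC; exact: measurable_mem.
  - exact: (IH (fun u => Q (false :: u))).
apply/seteqP; split => X /=.
  by case: asboolP => Xy h; [left|right].
by case: asboolP => Xy [] [].
Qed.

Lemma trace_mask X s : trace X s = mask [seq `[< X y >] | y <- s] s.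
Proof. by rewrite /trace filter_mask. Qed.

Lemma count_trace X s (p : pred V) :
  count p (trace X s) = count (fun y => `[< X y >]) [seq y <- s | p y].
Proof. by rewrite !count_filter; apply: eq_count => y /=; rewrite andbC. Qed.

End traces.

Section two_clusters.
Context (R : realType) (V : choiceType) (cV : countable [set: V])
  (dT : measure_display) (T : measurableType dT) (P : probability T R)
  (G : {mfun T >-> graph_space V}) (BK : BK_inequality P G) (o : V)
  (dT' : measure_display) (T' : measurableType dT') (P' : probability T' R)
  (C1 C2 : {mfun T' >-> subset_space V})
  (copies : independent_copies_of_component P G o P' C1 C2)
  (l : V -> V -> nat) (a D c C : R).
Hypotheses (lq : quasi_ultrametric l) (c0 : 0 < c) (a0 : 0 < a) (a1 : a < 1)
  (aD1 : 1 < a * D) (a4D3 : a ^+ 4 * D ^+ 3 < 1) (lgr : level_growth l c D)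
  (lfin : forall x j, exists2 s, uniq s & forall y, (y \in s) = (l x y <= j)%N)
  (Cpos : 0 < C) (tau_le : forall x y, two_point P G x y <= C * a ^+ l x y).

Local Notation beta := (beta a D).
Local Notation hit X s := (count (fun y => `[< X y >]) s).

Lemma measurable_copy1 (S : set (subset_space V)) : measurable S ->
  measurable (C1 @^-1` S).
Proof. by move=> mS; rewrite -[X in measurable X]setTI; exact: measurable_funP. Qed.

Lemma measurable_copy2 (S : set (subset_space V)) : measurable S ->
  measurable (C2 @^-1` S).
Proof. by move=> mS; rewrite -[X in measurable X]setTI; exact: measurable_funP. Qed.

Lemma measurable_hit s (t : R) :
  measurable [set X : subset_space V | t <= (hit X s)%:R].
Proof.
rewrite (_ : [set X | _] =
    [set X : subset_space V | t <= (count id [seq `[< X y >] | y <- s])%:R]).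
  exact: (measurable_pattern s (fun u => t <= (count id u)%:R)).
by apply/seteqP; split => X /=; rewrite count_map.
Qed.

Lemma copies_two_point y : prob P' (C1 @^-1` [set X | X y] `&`
   C2 @^-1` [set X | X y]) = two_point P G o y ^+ 2.
Proof.
have [e1 e2 e3] := copies; have mX := measurable_mem y.
by rewrite /prob e3// e1// e2// fineM ?fin_num_measure//; exact: measurable_graph_connected.
Qed.

Lemma copies_hit s (t : R) :
  (prob P' [set w | t <= (hit (C1 w) s)%:R] =
     prob P [set w | t <= (hit (component (G w) o) s)%:R]) /\
  (prob P' [set w | t <= (hit (C2 w) s)%:R] =
     prob P [set w | t <= (hit (component (G w) o) s)%:R]).
Proof.
have [e1 e2 _] := copies; have mX := measurable_hit s t.
by split; congr fine; [exact: (e1 _ mX)|exact: (e2 _ mX)].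
Qed.

(** First moment: by independence a point [y] is common with probability
    [tau(o,y)^2]. *)
Lemma common_far_le : exists2 B : R, 0 < B & forall M,
  measurable [set w | exists y, (M < l o y)%N /\ (C1 w y /\ C2 w y)] /\
  prob P' [set w | exists y, (M < l o y)%N /\ (C1 w y /\ C2 w y)] <= B * beta ^+ M.
Proof.
have [B B0 BP] := green_tail_le c0 a0 aD1 a4D3 lgr.
exists (C ^+ 2 * B); first by rewrite mulr_gt0// exprn_gt0.
move=> M.
pose F y := if (M < l o y)%N then
  C1 @^-1` [set X | X y] `&` C2 @^-1` [set X | X y] else set0.
have mF y : measurable (F y).
  rewrite /F; case: ifP => // _; apply: measurableI.
    by apply: measurable_copy1; exact: measurable_mem.
  by apply: measurable_copy2; exact: measurable_mem.
have EF : [set w | exists y, (M < l o y)%N /\ (C1 w y /\ C2 w y)] = \bigcup_y F y.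
  apply/seteqP; split => w [y].
    by move=> [My ?]; exists y => //; rewrite /F My.
  by rewrite /F => _; case: ifP => // My []; exists y.
have mE : measurable (\bigcup_y F y) by exact: countable_bigcupT_measurable.
rewrite EF; split => //.
have := @prob_weighted_union_le _ _ _ P' V 'I_1 (fun=> 1) (fun=> \bigcup_y F y)
  (fun=> F) (C ^+ 2 * B * beta ^+ M) cV.
rewrite big_ord1 mul1r; apply => //.
  by move=> _ w [y _ ?]; exists y.
move=> s us; under eq_bigr do rewrite big_ord1 mul1r.
rewrite (bigID (fun y => M < l o y)%N)/= [X in _ + X]big1 ?addr0; last first.
  by move=> y /negPf h; rewrite /F h /prob measure0.
rewrite -big_filter.
apply: (@le_trans _ _ (\sum_(y <- s | (M < l o y)%N) C ^+ 2 * (a ^+ l o y * a ^+ l o y))).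
  rewrite big_filter; apply: ler_sum => y My; rewrite /F My copies_two_point.
  rewrite -expr2 -exprMn.
  apply: lerXn2r; rewrite ?nnegrE ?prob_ge0//.
  by rewrite mulr_ge0 ?exprn_ge0// ltW.
rewrite -mulr_sumr -mulrA ler_wpM2l ?exprn_ge0 ?(ltW Cpos)//.
rewrite -big_filter; apply: BP; first exact: filter_uniq.
exact: filter_all.
Qed.

(** Hitting a finite list is an event about the component, so the tail passes
    to the two copies. *)
Lemma copies_count_tail : exists2 k : R, 0 < k &
  forall (s : seq V) (S : R), 1 <= S ->
    (forall v, \sum_(y <- s) beta ^+ l v y <= S) -> forall t,
  prob P' [set w | t <= (hit (C1 w) s)%:R] <= 2 * expR (- (k * t / S)) /\
  prob P' [set w | t <= (hit (C2 w) s)%:R] <= 2 * expR (- (k * t / S)).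
Proof.
have [k k0 kP] := cluster_count_tail cV BK lq c0 a0 a1 aD1 a4D3 lgr Cpos tau_le.
exists k => // s S S1 SP t; have [-> ->] := copies_hit s t.
by have := kP s S S1 SP o t.
Qed.

(** Condition on the membership pattern [b] of the second cluster along the
    list [s], which determines its trace. If the potential of the trace is at
    most [S0], of order [(D beta)^m], the first cluster meets it in [D^m]
    points with probability at most [2 exp (- k D^m / S0)], and different
    patterns exclude each other. If not, [clustered_potential_le] provides a
    centre [z] in [s] and a level [j] for which the second cluster has at
    least [K beta^-m (D beta)^j] points in a ball with potential of order [(D
    beta)^j]. Such an event has probability exponentially small in [K
    beta^-m], and [K] is chosen so large that this beats the number of pairs
    [(z, j)], which is at most exponential in [beta^-m]. *)
Lemma common_near_le : exists B k : R, [/\ 0 < B, 0 < k &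
  forall m M s, beta^-1 ^+ m <= M%:R <= 2 * beta^-1 ^+ m ->
    uniq s -> all (fun y => l o y <= M)%N s ->
  let near := [set w | D ^+ m <=
     (count (fun y => `[< C1 w y /\ C2 w y >]) s)%:R] in
  measurable near /\ prob P' near <= B * expR (- (k * beta^-1 ^+ m))].
Proof.
have [k k0 kP] := copies_count_tail.
have [B1 B10 B1P] := ball_potential_le c0 a0 aD1 a4D3 lgr.
have [B2 B21 B2P] := clustered_potential_le lq c0 a0 aD1 a4D3 lgr.
have b0 := beta_gt0 a0 aD1; have b1 := beta_lt1 a0 aD1 a4D3.
have D1 := D_gt1 a0 a1 aD1; have D0 := lt_trans ltr01 D1.
have Db1 := Dbeta_gt1 aD1.
pose B1' := Num.max 1 B1.
have B1'1 : 1 <= B1' by rewrite le_max lexx.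
have B1'B : B1 <= B1' by rewrite le_max lexx orbT.
(* There are at most [c D^M (M + 1) <= 3 c exp ((2 ln D + 1) X)] pairs [(z,
   j)], where [X = beta^-m] and [M <= 2 X]; this [K] makes each bad event have
   probability at most [2 exp (- (2 ln D + 2) X)]. *)
pose K := B1' * (2 * ln D + 2) / k.
have lnD0 : 0 <= ln D by rewrite ln_ge0// ltW.
have K0 : 0 <= K by rewrite /K !mulr_ge0 ?invr_ge0 ?(ltW k0)//; lra.
have kK : k * K = B1' * (2 * ln D + 2) by rewrite /K mulrC divfK// gt_eqF.
clearbody K.
pose kg := k / (B2 * (1 + K)).
have BK0 : 1 <= B2 * (1 + K) by nra.
have kg0 : 0 < kg by rewrite divr_gt0//; lra.
exists (6 * c + 2), (Num.min 1 kg); split.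
- by have := c0; lra.
- by rewrite lt_min ltr01.
move=> m M s; set X := beta^-1 ^+ m => /andP[XM MX] us sM near.
have X1 : 1 <= X.
  by rewrite /X exprn_ege1// invf_ge1// ltW.
have X0 : 0 < X by lra.
pose S0 := B2 * (1 + K) * (D * beta) ^+ m.
have Dbm1 : 1 <= (D * beta) ^+ m by rewrite exprn_ege1// ltW.
have S01 : 1 <= S0 by rewrite /S0; nra.
pose J := (size s).-tuple bool.
pose pat w := [seq `[< C2 w y >] | y <- s].
pose E (b : J) := [set w | pat w = b].
pose H (b : J) := [set w | D ^+ m <= (hit (C1 w) (mask b s))%:R].
pose good (b : J) := `[< forall v, \sum_(y <- mask b s) beta ^+ l v y <= S0 >].
have mE b : measurable (E b).
  exact: (measurable_copy2 (measurable_pattern s (fun u => u = b))).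
have mH b : measurable (H b).
  exact: (measurable_copy1 (measurable_hit _ _)).
have nearE : near = \bigcup_(b in [set: J]) (H b `&` E b).
  have cE w : count (fun y => `[< C1 w y /\ C2 w y >]) s =
      hit (C1 w) (mask (pat w) s).
    rewrite -trace_mask count_filter; apply: eq_count => y /=.
    by apply/asboolP/andP => -[]; [move=> /asboolP ? /asboolP|move=> /asboolP ? /asboolP].
  apply/seteqP; split => w /=.
    rewrite /near /= cE => h.
    have pw : size (pat w) == size s by rewrite size_map.
    by exists (Tuple pw).
  move=> [b _ [Hb Eb]]; have Eb' : pat w = b by exact: Eb.
  by rewrite /near /= cE Eb'; exact: Hb.
have mnear : measurable near.
  rewrite nearE; apply: fin_bigcup_measurable; first exact: finite_finset.
  by move=> b _; exact: measurableI.
split => //.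
(* The index [q] stands for the centre [z] and the level [j = q.2 + m + 1]. *)
pose L (q : 'I_(size s) * 'I_M.+1) :=
  [seq y <- s | l (tnth (in_tuple s) q.1) y <= q.2 + m.+1]%N.
pose Kq (q : 'I_(size s) * 'I_M.+1) := K * X * (D * beta) ^+ (q.2 + m.+1).
pose bad q := [set w | Kq q <= (hit (C2 w) (L q))%:R].
have mbad q : measurable (bad q).
  exact: (measurable_copy2 (measurable_hit _ _)).
pose ev (q : ('I_(size s) * 'I_M.+1) + J) := match q with
  | inl q => bad q | inr b => if good b then H b `&` E b else set0 end.
have mev q : measurable (ev q).
  by case: q => [q|b] //=; case: ifP => // _; exact: measurableI.
have near_ev w : near w -> exists q, ev q w.
  rewrite nearE => -[b _ [Hb Eb]].
  have [gb|] := boolP (good b); first by exists (inr b); rewrite /= gb.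
  move/asboolPn => nb; apply: contrapT => /forallNP nev; apply: nb.
  have Eb' : pat w = b by exact: Eb.
  rewrite -Eb' -trace_mask; apply: (B2P o K m M) => //.
  - exact: filter_uniq.
  - by apply/allP => y; rewrite mem_filter => /andP[_ ys]; exact: (allP sM).
  - move=> z j; rewrite mem_filter => /andP[_ zs] /andP[mj jM].
    have jM' : (j - m.+1 < M.+1)%N by move: mj jM; clear; lia.
    have zs' : (index z s < size s)%N by rewrite index_mem.
    have := nev (inl (Ordinal zs', Ordinal jM')).
    rewrite /= /bad /= /Kq /L /= => /negP; rewrite -ltNge subnK// count_trace.
    rewrite (_ : tnth _ _ = z); first exact: ltW.
    by rewrite (tnth_nth z)/= nth_index.
apply: (le_trans (prob_finite_union_le P' mnear mev near_ev)).
rewrite big_sumType/= mulrDl; apply: lerD.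
  have badle q : prob P' (bad q) <= 2 * expR (- ((2 * ln D + 2) * X)).
    have S1 : 1 <= B1' * (D * beta) ^+ (q.2 + m.+1).
      by rewrite -[leLHS]mulr1 ler_pM// exprn_ege1// ltW.
    have [|_] := kP (L q) _ S1 _ (Kq q).
      move=> v; apply: le_trans (B1P (tnth (in_tuple s) q.1) (q.2 + m.+1)%N (L q) _ _ v) _.
      - exact: filter_uniq.
      - exact: filter_all.
      - by rewrite ler_wpM2r// exprn_ge0// ltW// mulr_gt0.
    rewrite (_ : k * Kq q / _ = (2 * ln D + 2) * X)//.
    have Dq : (D * beta) ^+ (q.2 + m.+1) != 0.
      by rewrite expf_neq0// mulf_neq0// gt_eqF.
    rewrite /Kq; set x := (D * beta) ^+ _ in Dq *.
    have kn0 : k != 0 by rewrite gt_eqF.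
    have B1n0 : B1' != 0 by rewrite gt_eqF//; lra.
    apply: (canLR (mulfK _)); first by rewrite mulf_neq0.
    by rewrite !mulrA kK; lra.
  apply: (@le_trans _ _ (\sum_(q : 'I_(size s) * 'I_M.+1)
      2 * expR (- ((2 * ln D + 2) * X)))).
    by apply: ler_sum => q _; exact: badle.
  rewrite sumr_const card_prod !card_ord -[X in X <= _]mulr_natl natrM.
  have sizes : (size s)%:R <= c * expR (2 * ln D * X).
    apply: le_trans (lgr us sM) _; rewrite ler_wpM2l ?(ltW c0)//.
    rewrite -{1}[D]lnK ?posrE// -expRM_natl ler_expR.
    by rewrite [2 * _]mulrC -mulrA mulrC ler_wpM2l.
  have M3 : M.+1%:R <= 3 * expR X.
    have := expR_ge1Dx X; rewrite -natr1 => h; lra.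
  apply: (@le_trans _ _ (c * expR (2 * ln D * X) * (3 * expR X) *
      (2 * expR (- ((2 * ln D + 2) * X))))).
    rewrite ler_wpM2r ?mulr_ge0 ?expR_ge0//.
    by apply: ler_pM.
  have -> : c * expR (2 * ln D * X) * (3 * expR X) *
      (2 * expR (- ((2 * ln D + 2) * X))) =
     6 * c * (expR (2 * ln D * X) * expR X * expR (- ((2 * ln D + 2) * X))) by lra.
  rewrite -!expRD ler_wpM2l ?mulr_ge0 ?(ltW c0)// ler_expR.
  have : Num.min 1 kg <= 1 by rewrite ge_min lexx.
  by nra.
have evle b : prob P' (ev (inr b)) <= 2 * expR (- (kg * X)) * prob P' (E b).
  rewrite /ev; case: ifP => [gb|_]; last first.
    by rewrite {1}/prob measure0 mulr_ge0 ?prob_ge0// mulr_ge0 ?expR_ge0.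
  have [_ _ ind] := copies.
  rewrite {1}/prob (ind [set Y : subset_space V | D ^+ m <= (hit Y (mask b s))%:R]
     [set Y : subset_space V | [seq `[< Y y >] | y <- s] = b]); last 2 first.
  - exact: measurable_hit.
  - exact: (measurable_pattern s (fun u => u = b)).
  rewrite fineM; last 2 first.
  - by apply: fin_num_measure; exact: mH.
  - by apply: fin_num_measure; exact: mE.
  rewrite ler_wpM2r ?prob_ge0//.
  have [h _] := kP (mask b s) S0 S01 (asboolW gb) (D ^+ m).
  apply: le_trans h _.
  rewrite (_ : k * D ^+ m / S0 = kg * X)//.
  have Dm : D ^+ m != 0 by rewrite expf_neq0// gt_eqF.
  rewrite /S0 /kg /X (exprMn _ D) invfM mulrACA; congr (_ * _).
  by rewrite invfM mulrA mulfV// mul1r exprVn.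
apply: (@le_trans _ _ (\sum_(b : J) 2 * expR (- (kg * X)) * prob P' (E b))).
  by apply: ler_sum => b _; exact: evle.
rewrite -mulr_sumr -[leRHS]mulr1 ler_pM ?mulr_ge0 ?expR_ge0 ?sumr_ge0//.
- by move=> b _; exact: prob_ge0.
- rewrite ler_wpM2l// ler_expR lerN2 ler_wpM2r ?(ltW X0)//.
  by rewrite ge_min lexx orbT.
(* The events [E b] are disjoint, so their probabilities add up to at most
   one. *)
have := @prob_weighted_le _ _ _ P' J 'I_1 (fun=> 1) E (fun=> 1) (fun=> setT).
rewrite big_ord1 mul1r /prob probability_setT /=.
under eq_bigr do rewrite mul1r.
apply => // w; rewrite big_ord1 indicT mul1r.
have pw : size (pat w) == size s by rewrite size_map.
rewrite (bigD1 (Tuple pw))//= big1 ?addr0 => [|b bw].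
  by rewrite mul1r indicE; case: (_ \in _).
rewrite mul1r indicE memNset// /E /= => pb.
by move/eqP: bw; apply; apply/val_inj; rewrite /= pb.
Qed.

(** The cut-off level [M] is chosen between [beta^-m] and [2 beta^-m]: then
    [beta^M] is exponentially small in [beta^-m], while the number of points
    up to level [M] is at most exponential in it. *)
Lemma intersection_tail : exists B k : R, [/\ 0 < B, 0 < k & forall m,
  exists A : set T', [/\ measurable A,
    forall w, ((D ^+ m)%:E <= counting (C1 w `&` C2 w))%E -> A w &
    prob P' A <= B * expR (- (k * beta^-1 ^+ m))]].
Proof.
have [Bf Bf0 far] := common_far_le.
have [Bn [kn [Bn0 kn0 near]]] := common_near_le.
have b0 := beta_gt0 a0 aD1; have b1 := beta_lt1 a0 aD1 a4D3.
pose kf := ln beta^-1.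
have kf0 : 0 < kf by rewrite ln_gt0// invf_gt1.
exists (Bf + Bn), (Num.min kf kn); split.
- by rewrite addr_gt0.
- by rewrite lt_min kf0.
move=> m; set X := beta^-1 ^+ m.
have X1 : 1 <= X by rewrite /X exprn_ege1// invf_ge1// ltW.
pose M := (Num.truncn X).+1.
have XM : X <= M%:R by apply: ltW; exact: truncnS_gt.
have MX : M%:R <= 2 * X.
  have : (Num.truncn X)%:R <= X by rewrite truncn_le//; lra.
  rewrite /M -natr1; lra.
have [s us sE] := lfin o M.
have sM : all (fun y => l o y <= M)%N s by apply/allP => y; rewrite sE.
have [mN pN] := near m M s (introT andP (conj XM MX)) us sM.
have [mF pF] := far M.
set N := [set w | D ^+ m <= _] in mN pN.
set F := [set w | exists y, _] in mF pF.
exists (F `|` N); split; first exact: measurableU.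
  move=> w Dw; have [Fw|nF] := pselect (F w); first by left.
  right; move: Dw; rewrite (counting_uniq _ us) ?lee_fin// => y [y1 y2] /=.
  by rewrite sE leqNgt; apply/negP => My; apply: nF; exists y.
apply: (@le_trans _ _ (prob P' F + prob P' N)).
  rewrite -lee_fin EFinD -!probE//; last exact: measurableU.
  exact: measureU2.
rewrite mulrDl; apply: lerD.
  apply: le_trans pF _; rewrite ler_wpM2l ?(ltW Bf0)//.
  rewrite -[beta]invrK exprVn -[beta^-1]lnK ?posrE ?invr_gt0// -/kf.
  rewrite -expRM_natl -expRN ler_expR lerN2.
  rewrite mulrC ler_pM//.
  - by lra.
  - by rewrite le_min !ltW.
  - by rewrite ge_min lexx.
apply: le_trans pN _; rewrite ler_wpM2l ?(ltW Bn0)// ler_expR lerN2.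
rewrite ler_wpM2r//; first by lra.
by rewrite ge_min lexx orbT.
Qed.

End two_clusters.

(** * From tails to an exponential moment *)

Section exponential_moment.
Context (R : realType) (dT : measure_display) (T : measurableType dT)
  (P : probability T R).

(** The integral of a nonnegative function is a supremum over the simple
    functions below it, so that monotonicity holds without measurability. *)
Lemma ge0_integral_mono (f g : T -> \bar R) :
  (forall t, 0 <= f t)%E -> (forall t, f t <= g t)%E ->
  (\int[P]_t f t <= \int[P]_t g t)%E.
Proof.
move=> f0 fg.
have g0 t : (0 <= g t)%E by exact: le_trans (fg t).
rewrite !ge0_integralTE//; apply: le_ereal_sup => _ [h /= hf <-].
by exists h => // t; exact: le_trans (fg t).
Qed.

Lemma bernoulli_le (b : R) n : 1 <= b -> n%:R * (b - 1) <= b ^+ n.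
Proof.
move=> b1; have h : 1 + n%:R * (b - 1) <= b ^+ n; last lra.
elim: n => [|n IH]; first by rewrite expr0 mul0r addr0.
have n0 : 0 <= n%:R * (b - 1) ^+ 2 :> R by rewrite mulr_ge0// exprn_ge0// subr_ge0.
rewrite exprS -natr1; apply: (@le_trans _ _ (b * (1 + n%:R * (b - 1)))); first lra.
by rewrite ler_wpM2l//; lra.
Qed.

(** If [D^m <= N t < D^(m+1)] then [N t `^ s <= b^(m+1)], so the integrand is
    dominated by a constant plus the series of the [exp (kappa b^(m+1))] over
    the events [A m]. The choice of [kappa] makes the exponent [k b^m / 2],
    which the tail beats, and [b^m] grows at least linearly. Where [N t] is
    infinite all the [A m] occur and the series diverges, so the domination
    holds there too. *)
Lemma stretched_exponential_moment (N : T -> \bar R) (D b s B k : R) :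
  1 < D -> 1 < b -> 0 < s -> D `^ s = b -> 0 < k -> 0 <= B ->
  (forall t, N t = +oo%E \/ exists n : nat, N t = n%:R%:E) ->
  (forall m, exists A : set T, [/\ measurable A,
     forall t, ((D ^+ m)%:E <= N t)%E -> A t &
     prob P A <= B * expR (- (k * b ^+ m))]) ->
  exists2 kappa : R, 0 < kappa &
    (\int[P]_t expeR (kappa%:E * (N t `^ s)) < +oo)%E.
Proof.
move=> D1 b1 s0 Dsb k0 B0 Nval /choice[A AP].
have mA m : measurable (A m) by have [] := AP m.
have NA m t : ((D ^+ m)%:E <= N t)%E -> A m t by have [_ + _] := AP m; apply.
have pA m : prob P (A m) <= B * expR (- (k * b ^+ m)) by have [] := AP m.
have b0 : 0 < b by lra.
have D0 : 0 < D by lra.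
pose kappa := k / (2 * b).
have kap0 : 0 < kappa by rewrite divr_gt0// mulr_gt0.
exists kappa => //.
pose e m := expR (kappa * b ^+ m.+1).
have e1 m : 1 <= e m.
  by rewrite -[leLHS]expR0 ler_expR mulr_ge0 ?exprn_ge0 ?ltW.
pose ser t := (\sum_(0 <= m <oo) ((e m)%:E * (\1_(A m) t)%:E))%E.
have term0 m t : (0 <= (e m)%:E * (\1_(A m) t)%:E :> \bar R)%E.
  by rewrite mule_ge0// lee_fin (le_trans _ (e1 m)).
have ser0 t : (0 <= ser t)%E by apply: nneseries_ge0.
have term m t : A m t -> ((e m)%:E * (\1_(A m) t)%:E)%E = (e m)%:E.
  by move=> At; rewrite indicE mem_set// mule1.
have ser_ge t m : A m t -> ((e m)%:E <= ser t)%E.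
  move=> At; apply: le_trans (nneseries_lim_ge m.+1 _) => //.
  by rewrite big_nat_recr//= -{1}(term _ _ At) leeDr// sume_ge0.
have dom t : (expeR (kappa%:E * (N t `^ s)) <= (expR kappa)%:E + ser t)%E.
  have [Ny|[n Nn]] := Nval t.
    suff -> : ser t = +oo%E by rewrite addey// leey.
    apply/eqyP => r r0.
    apply: le_trans (nneseries_lim_ge (Num.truncn r).+1 _) => //.
    apply: (@le_trans _ _ (\sum_(0 <= m < (Num.truncn r).+1) 1%:E)%E).
      rewrite sumEFin lee_fin sumr_const_nat subn0.
      by apply: ltW; exact: truncnS_gt.
    apply: lee_sum => m _; rewrite term ?lee_fin//.
    by apply: NA; rewrite Ny leey.
  rewrite Nn poweR_EFin -EFinM /=.
  have [->|n0] := posnP n.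
    rewrite powR0 ?gt_eqF// mulr0 expR0.
    apply: (@le_trans _ _ ((expR kappa)%:E)).
      by rewrite lee_fin -[leLHS]expR0 ler_expR ltW.
    by rewrite leeDl.
  (* A positive integer [n] lies in one block [D^m <= n < D^(m+1)]. *)
  have ex : exists m, n%:R < D ^+ m.
    exists (Num.truncn (n%:R / (D - 1))).+1.
    apply: lt_le_trans (bernoulli_le _ (ltW D1)).
    by rewrite -ltr_pdivrMr ?subr_gt0//; exact: truncnS_gt.
  case: (ex_minnP ex) => -[|m] Dm minm.
    by move: Dm; rewrite expr0 ltNge ler1n n0.
  have mn : D ^+ m <= n%:R by rewrite leNgt; apply/negP => /minm; rewrite ltnn.
  apply: (@le_trans _ _ (ser t)); last by rewrite leeDr// lee_fin expR_ge0.
  have At : A m t by apply: NA; rewrite Nn lee_fin.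
  apply: le_trans (ser_ge _ _ At); rewrite lee_fin ler_expR ler_wpM2l ?(ltW kap0)//.
  rewrite -Dsb -powR_mulrn ?powR_ge0// powRAC powR_mulrn ?(ltW D0)//.
  by apply: ge0_ler_powR; rewrite ?nnegrE ?(ltW s0) ?exprn_ge0 ?(ltW D0) ?(ltW Dm).
pose q := expR (- (k / 2 * (b - 1))).
have q0 : 0 <= q by rewrite expR_ge0.
have q1 : q < 1 by rewrite expR_lt1 oppr_lt0 mulr_gt0 ?divr_gt0// subr_gt0.
have eA m : e m * prob P (A m) <= B * q ^+ m.
  apply: (@le_trans _ _ (e m * (B * expR (- (k * b ^+ m))))).
    by rewrite ler_wpM2l// expR_ge0.
  rewrite mulrCA ler_wpM2l// /e -expRD /q -expRM_natl ler_expR.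
  have -> : kappa * b ^+ m.+1 = k / 2 * b ^+ m.
    by rewrite /kappa exprS invfM mulrA -[_ * b]mulrA -[_ * b]mulrA mulVf ?mulr1// gt_eqF.
  have := bernoulli_le m (ltW b1); nra.
have mterm m : measurable_fun [set: T] (fun t => (e m)%:E * (\1_(A m) t)%:E : \bar R)%E.
  apply: emeasurable_funM => //.
  by apply/measurable_EFinP; exact: measurable_indic.
have mser : measurable_fun [set: T] ser by apply: ge0_emeasurable_sum.
apply: (@le_lt_trans _ _ (\int[P]_t ((expR kappa)%:E + ser t))%E).
  by apply: ge0_integral_mono => // t; exact: expeR_ge0.
rewrite ge0_integralD//.
rewrite integral_cst// [X in (_ * X)%E](_ : _ = 1%E) ?mule1; last first.
  exact: probability_setT.
rewrite lte_add_pinfty ?ltry//.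
rewrite /ser integral_nneseries//.
apply: (@le_lt_trans _ _ (B / (1 - q))%:E); last exact: ltry.
apply: lime_le.
  by apply: is_cvg_nneseries => m _ _; exact: integral_ge0.
apply: nearW => n.
apply: (@le_trans _ _ (\sum_(0 <= m < n) (B * q ^+ m)%:E)%E).
  apply: lee_sum => m _; rewrite ge0_integralZl//; last 2 first.
  - by apply/measurable_EFinP; exact: measurable_indic.
  - by rewrite lee_fin expR_ge0.
  rewrite integral_indic// setIT [X in (_ * X)%E](_ : _ = (prob P (A m))%:E).
    by rewrite -EFinM lee_fin.
  exact: probE.
rewrite sumEFin lee_fin -mulr_sumr ler_wpM2l//.
by have := geometric_tail_le 0 n q0 q1; rewrite expr0 mul1r.
Qed.

End exponential_moment.

(** * The dyadic level of a metric of polynomial growth *)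

Section dyadic_level.
Context (R : realType) (V : metricType R).
Implicit Types x y z : V.

Fact dyadic_level_exists x y : exists n, mdist x y <= 2 ^+ n :> R.
Proof.
exists (Num.truncn (mdist x y)).+1.
apply: ltW; apply: lt_le_trans (truncnS_gt _) _.
rewrite -natrX ler_nat; apply: ltnW; exact: ltn_expl.
Qed.

Definition dyadic_level x y := ex_minn (dyadic_level_exists x y).

Lemma dyadic_level_le x y j : (dyadic_level x y <= j)%N = (mdist x y <= 2 ^+ j).
Proof.
rewrite /dyadic_level; case: ex_minnP => n n1 n2; apply/idP/idP; last exact: n2.
by move=> nj; apply: le_trans n1 _; apply: ler_weXn2l => //; rewrite ler1n.
Qed.

Lemma dyadic_level_quasi : quasi_ultrametric dyadic_level.
Proof.
split=> [x y|y x z].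
  have sym j : (dyadic_level x y <= j)%N = (dyadic_level y x <= j)%N.
    by rewrite !dyadic_level_le metric_sym.
  by apply/eqP; rewrite eqn_leq; apply/andP; split; [rewrite sym|rewrite -sym].
rewrite dyadic_level_le; apply: le_trans (metric_triangle _ y _) _.
by rewrite exprS mulr_natl mulr2n lerD// -dyadic_level_le ?leq_maxl ?leq_maxr.
Qed.

(** At level [n + 1] the distance exceeds [2^n]; the factor [2 `^ alpha]
    absorbs the difference of one level. *)
Lemma green_dyadic (alpha : R) x y : 0 < alpha ->
  green alpha x y <= 2 `^ alpha * (2 `^ (- alpha)) ^+ dyadic_level x y.
Proof.
move=> al0; have d0 := mdist_ge0 x y.
have p0 := powR_ge0 (mdist x y) alpha.
have [l0|] := posnP (dyadic_level x y).
  rewrite l0 expr0 mulr1 /green; apply: (@le_trans _ _ 1).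
    by rewrite invf_le1; lra.
  by rewrite -[leLHS](powRr0 2) ler_powR ?ler1n// ltW.
case E : (dyadic_level x y) => [//|n] _.
have : 2 ^+ n < mdist x y by rewrite ltNge -dyadic_level_le E ltnn.
move=> n2; have n0 : 0 < (2 : R) ^+ n by rewrite exprn_gt0.
have two0 : 0 < (2 : R) `^ alpha by rewrite powR_gt0.
rewrite powRN exprVn exprS invfM mulrA mulfV ?gt_eqF// mul1r /green.
rewrite lef_pV2 ?posrE ?exprn_gt0//; last lra.
apply: (@le_trans _ _ (mdist x y `^ alpha)); last lra.
rewrite -powR_mulrn ?powR_ge0// powRAC powR_mulrn//.
by apply: ge0_ler_powR; rewrite ?nnegrE ?(ltW al0) ?(ltW n0) ?(ltW n2).
Qed.

Variable d : R.
Hypothesis growth : polynomial_growth V d.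

Lemma dyadic_level_growth :
  exists2 c, 0 < c & level_growth dyadic_level c (2 `^ d).
Proof.
have [c1 [c2 [_ c20 h]]] := growth.
exists c2 => // x j s us /allP sj.
have := h x (2 ^+ j) (exprn_ege1 _ (ler1n R 2)).
rewrite -powR_mulrn// powRAC powR_mulrn ?powR_ge0// => /andP[_].
apply: counting_le_size => // y /sj; rewrite dyadic_level_le.
by rewrite /closed_ball_mdist/= powR_mulrn.
Qed.

Lemma dyadic_ball_list x j :
  exists2 s, uniq s & forall y, (y \in s) = (dyadic_level x y <= j)%N.
Proof.
have [c1 [c2 [_ c20 h]]] := growth.
have /andP[_ /counting_le_finite] := h x (2 ^+ j) (exprn_ege1 _ (ler1n R 2)).
move=> /finite_seqP[s sE]; exists (undup s); first exact: undup_uniq.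
move=> y; rewrite mem_undup dyadic_level_le.
have /= e := congr1 (fun S : set V => S y) sE.
by apply/idP/idP; rewrite -/(is_true _) -e.
Qed.

End dyadic_level.

(** * The exponential moment *)

Theorem theorem1p1 (R : realType) (V : metricType R) (d : R) (o : V)
  (countableV : countable [set: V])
  (d_ge1 : 1 <= d)
  (growthV : polynomial_growth V d)
  (dT : measure_display) (T : measurableType dT) (P : probability T R)
  (G : {mfun T >-> graph_space V})
  (BK : BK_inequality P G)
  (alpha : R) (alpha_gt : 3 * d / 4 < alpha) (alpha_lt : alpha < d)
  (tau_le : exists C : R, 0 < C /\
    forall x y : V, (tau P G x y <= (C * green alpha x y)%:E)%E)
  (dT' : measure_display) (T' : measurableType dT') (P' : probability T' R)
  (C0 C0' : {mfun T' >-> subset_space V})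
  (copies : independent_copies_of_component P G o P' C0 C0') :
  exists kappa : R, 0 < kappa /\
    (\int[P']_w expeR (kappa%:E *
       (counting (C0 w `&` C0' w) `^ (2 * alpha / d - 1))) < +oo)%E.
Proof.
have d0 : 0 < d by lra.
have al0 : 0 < alpha by lra.
pose a : R := 2 `^ (- alpha); pose D : R := 2 `^ d.
have two1 : 1 < 2 :> R by rewrite ltr1n.
have pow_gt1 (x : R) : 0 < x -> 1 < 2 `^ x.
  move=> x0; rewrite [ltLHS](_ : 1 = 1 `^ x); last by rewrite powR1.
  by apply: gt0_ltr_powR; rewrite ?nnegrE.
have pow_lt1 (x : R) : 0 < x -> 2 `^ (- x) < 1.
  by move=> x0; rewrite powRN invf_lt1 ?powR_gt0// pow_gt1.
have pow2D (x y : R) : (2 : R) `^ x * 2 `^ y = 2 `^ (x + y).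
  by rewrite powRD// pnatr_eq0 implybT.
have pow2X (x : R) n : ((2 : R) `^ x) ^+ n = 2 `^ (x * n%:R).
  by rewrite -powR_mulrn ?powR_ge0// powRrM.
have a0 : 0 < a by rewrite powR_gt0.
have a1 : a < 1 by exact: pow_lt1.
have D1 : 1 < D by exact: pow_gt1.
have aD1 : 1 < a * D by rewrite pow2D pow_gt1//; lra.
have a4D3 : a ^+ 4 * D ^+ 3 < 1.
  rewrite !pow2X pow2D -[_ + _]opprK; apply: pow_lt1; lra.
have [c c0 lgr] := dyadic_level_growth growthV.
have lfin := dyadic_ball_list growthV.
have [C [C_gt0 tauC]] := tau_le.
pose C2 := C * 2 `^ alpha.
have C20 : 0 < C2 by rewrite mulr_gt0// powR_gt0.
have two_point_le x y : two_point P G x y <= C2 * a ^+ dyadic_level x y.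
  rewrite -lee_fin -probE; last exact: measurable_graph_connected.
  apply: le_trans (tauC x y) _; rewrite lee_fin /C2 -mulrA ler_wpM2l ?(ltW C_gt0)//.
  exact: green_dyadic.
have [B [k [B0 k0 tail]]] := intersection_tail countableV BK copies
  (@dyadic_level_quasi R V) c0 a0 a1 aD1 a4D3 lgr lfin C20 two_point_le.
have b1 : 1 < (beta a D)^-1 by rewrite invf_gt1 ?beta_gt0 ?(beta_lt1 a0 aD1 a4D3).
have Ds : D `^ (2 * alpha / d - 1) = (beta a D)^-1.
  rewrite /beta pow2X pow2D -powRN /D -powRrM; congr (_ `^ _).
  by rewrite mulrBr mulrC divfK ?gt_eqF//; lra.
have s0 : 0 < 2 * alpha / d - 1.
  by rewrite subr_gt0 ltr_pdivlMr// mul1r; lra.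
have [kappa kappa0 fin] := stretched_exponential_moment D1 b1 s0 Ds k0 (ltW B0)
  (fun w => counting_value R (C0 w `&` C0' w)) tail.
by exists kappa; split.
Qed.
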